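(* Let $\alpha>0$, let $y_0,r_0\in BV(\mathbb R)$ with $y_0,r_0\ge1$, and let $w_\alpha$ and $v_\alpha$ be bounded, Lipschitz continuous weak solutions with values in $[1,\infty)$ of $\partial_t w=\partial_z\overline{W(w)}$ with initial data $\overline{y_0}$ and $\overline{r_0}$ respectively. If $y_0-r_0\in L^1(\mathbb R)$, then $w_\alpha(\cdot,t)-v_\alpha(\cdot,t)\in L^1(\mathbb R)$ for every $t>0$ and $$\|w_\alpha(\cdot,t)-v_\alpha(\cdot,t)\|_{L^1(\mathbb R)}\le\|y_0-r_0\|_{L^1(\mathbb R)}.$$ In particular, Lipschitz continuous weak solutions are uniquely determined by their initial data.
   Context: Kernel: $\Phi:[0,\infty)\to[0,\infty)$ is non-increasing with $\int_0^\infty\Phi(z)\,dz=1$ and $\int_0^\infty z\Phi(z)\,dz<\infty$; for $\alpha>0$, $\Phi_\alpha(z)=\alpha^{-1}\Phi(z/\alpha)$, and for bounded measurable $h:\mathbb R\to\mathbb R$, $\overline h(z)=\int_0^\infty\Phi_\alpha(\zeta)h(z+\zeta)\,d\zeta$. Flux: $V\in C^1([0,\infty))$ is non-increasing and $W:[1,\infty)\to\mathbb R$, $W(w)=V(1/w)$. A weak solution of $\partial_t w=\partial_z\overline{W(w)}$ on $[0,T]$ with initial datum $w_0$ means $\int_0^T\!\int_{\mathbb R}w\partial_t\varphi-\overline{W(w)}\partial_z\varphi\,dz\,dt=\int_{\mathbb R}w(z,T)\varphi(z,T)-w_0(z)\varphi(z,0)\,dz$ for all $\varphi\in C_0^\infty(\mathbb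 R\times[0,T])$, for every $T>0$. *)

(* Defs.v *)
From HB Require Import structures.
From mathcomp Require Import all_boot all_order all_algebra.
From mathcomp Require Import all_classical all_reals all_analysis.
Set Implicit Arguments. Unset Strict Implicit. Unset Printing Implicit Defensive.
Import Order.TTheory GRing.Theory Num.Theory.
Import numFieldNormedType.Exports.
Local Open Scope classical_set_scope.
Local Open Scope ring_scope.

Section defs.
Variable R : realType.
Notation leb := (@lebesgue_measure R).

Definition Rnonneg : set R := `[0, +oo[%classic.

(* Standing assumptions on the kernel Phi : [0,oo) -> [0,oo) (values of Phi
   outside [0,oo) are irrelevant). *)
Definition kernel_ok (Phi : R -> R) : Prop :=
  (forall z, 0 <= z -> 0 <= Phi z) /\
  (forall x y, 0 <= x -> x <= y -> Phi y <= Phi x) /\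
  (\int[leb]_(z in Rnonneg) (Phi z)%:E = 1)%E /\
  (\int[leb]_(z in Rnonneg) (z * Phi z)%:E < +oo)%E.

Definition kernel_scaled (Phi : R -> R) (alpha : R) (z : R) : R :=
  alpha^-1 * Phi (z / alpha).

Definition nl_avg (Phi : R -> R) (alpha : R) (h : R -> R) (z : R) : R :=
  Rintegral leb Rnonneg (fun zeta => kernel_scaled Phi alpha zeta * h (z + zeta)).

Definition flux_ok (V : R -> R) : Prop :=
  (exists dV : R -> R,
     {within Rnonneg, continuous dV} /\
     (forall x : R, 0 < x -> is_derive x 1 V (dV x)) /\
     (fun h : R => h^-1 * (V h - V 0)) @ (0:R)^'+ --> dV 0) /\
  (forall x y, 0 <= x -> x <= y -> V y <= V x).

Definition Wflux (V : R -> R) (w : R) : R := V w^-1.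

Fixpoint pderivs (l : seq bool) (phi : R -> R -> R) : R -> R -> R :=
  match l with
  | [::] => phi
  | b :: l' =>
      let g := pderivs l' phi in
      if b then fun z t => derive1 (fun z' => g z' t) z
      else fun z t => derive1 (fun t' => g z t') t
  end.

Definition smooth2 (phi : R -> R -> R) : Prop :=
  forall l : seq bool,
    continuous (fun p : R * R => pderivs l phi p.1 p.2) /\
    (forall z t, derivable (fun z' => pderivs l phi z' t) z 1 /\
                 derivable (fun t' => pderivs l phi z t') t 1).

Definition test_fun (phi : R -> R -> R) : Prop :=
  smooth2 phi /\
  exists M : R, forall z t, M < `|z| \/ M < `|t| -> phi z t = 0.

(* weak solution of  d_t w = d_z \overline{W(w)}  on [0,T] for every T > 0,
   with initial datum w0; w z t is defined for t >= 0 *)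
Definition weak_solution (Phi : R -> R) (alpha : R) (V : R -> R)
    (w : R -> R -> R) (w0 : R -> R) : Prop :=
  forall T : R, 0 < T ->
  forall phi : R -> R -> R, test_fun phi ->
    Rintegral (leb \x leb)%E ([set: R] `*` `[(0:R), T]%classic)
      (fun p : R * R =>
         w p.1 p.2 * derive1 (fun t' => phi p.1 t') p.2
         - nl_avg Phi alpha (fun z => Wflux V (w z p.2)) p.1
             * derive1 (fun z' => phi z' p.2) p.1)
    = Rintegral leb [set: R] (fun z => w z T * phi z T - w0 z * phi z 0).

Definition BV_R (f : R -> R) : Prop :=
  exists M : R, forall a b, a <= b -> (total_variation a b f <= M%:E)%E.

Definition lipschitz_sol (w : R -> R -> R) : Prop :=
  exists L : R, forall z z' t t', 0 <= t -> 0 <= t' ->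
    `|w z t - w z' t'| <= L * (`|z - z'| + `|t - t'|).

Definition bounded_sol (w : R -> R -> R) : Prop :=
  exists M : R, forall z t, 0 <= t -> `|w z t| <= M.

Definition values_ge1 (w : R -> R -> R) : Prop :=
  forall z t, 0 <= t -> 1 <= w z t.

End defs.

(* Main.v *)
Require Import Defs.
From HB Require Import structures.
From mathcomp Require Import all_boot all_order all_algebra.
From mathcomp Require Import all_classical all_reals all_analysis.
From mathcomp Require Import measurable_realfun.
From mathcomp Require Import ring lra.
Import Order.TTheory GRing.Theory Num.Theory.
Import numFieldNormedType.Exports.
Local Open Scope classical_set_scope.
Local Open Scope ring_scope.

(* Put u = w - v and f = W(w) - W(v), and let P be the scaled kernel, extended by
   0 to the negative half-line.  Testing with smoothed indicators of slabs turns
   the weak formulation into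
     int_a^b (u(z,t2) - u(z,t1)) dz = int_t1^t2 (avg f (b,t) - avg f (a,t)) dt.
   Since P is nonincreasing, (avg f (a+d) - avg f (a)) / d is a nonnegative
   average of the values f(a+s), s >= d, minus (up to O(d)) f(a) times the mass of
   that average.  As f has the sign of u and |f| <= c |u|, an explicit Euler step of
   length tau, with d = tau^2, gives up to O(tau^2)
     |u(a,t+tau)| + tau m |f(a,t)| <= |u(a,t)| + tau int p(s) |f(a+s,t)| ds,
   where p >= 0 has mass m.  Integrating against the tent of half-width N and
   iterating, the gain and loss terms cancel except for an error governed by the
   first moment of p: it is bounded uniformly in N, whence u(.,t) is in L^1, and it
   is O(|u|_1 / N) once that is known; N -> oo gives the contraction. *)

Set Implicit Arguments.
Unset Strict Implicit.
Unset Printing Implicit Defensive.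

Local Notation leb := (@lebesgue_measure _).

(** * A smooth step function *)

(** The kernel is only monotone and may jump, so minus its derivative is at best a measure.
    Difference quotients at scale [d] stand in for it: no Stieltjes integral appears, and the
    averaged flux is never differentiated. The modulus of [u] is not differentiated either. Under
    the step restriction [tau * P 0 * c <= 1], the loss term cannot reverse the sign of [u], so
    [|u - tau * m * f| = |u| - tau * m * |f|] holds exactly; since [m <= P 0], the restriction does
    not depend on [d]. The constant [c] is the maximum of |V'| on [0, 1], the interval that contains
    1/w when w >= 1. Gain and loss have equal mass because averaging preserves constants. The first
    moment of [p] is at most [1 + d * P 0], a discrete form of - int s P'(s) ds = int P = 1. The
    obstacle is that integrability of [u] at positive times is part of the conclusion. The weight
    must therefore have compact support, and the nonlocal gain term then carries mass across it; a
    shift by [s] raises a tent of half-width [N] by at most [s / N], which makes this transfer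
    measurable. *)

Definition expinv {R : realType} (n : nat) (x : R) : R :=
  if 0 < x then x ^- n * expR (- x^-1) else 0.

Lemma expinv_ge0 (R : realType) n (x : R) : 0 <= expinv n x.
Proof.
rewrite /expinv; case: ifPn => // x0.
by rewrite mulr_ge0 ?expR_ge0// invr_ge0 exprn_ge0// ltW.
Qed.

Lemma expinv_le0 (R : realType) n (x : R) : x <= 0 -> expinv n x = 0.
Proof. by move=> x0; rewrite /expinv ltNge x0. Qed.

Lemma expinv_gt0 (R : realType) n (x : R) : 0 < x -> 0 < expinv n x.
Proof.
by move=> x0; rewrite /expinv x0 mulr_gt0 ?expR_gt0// invr_gt0 exprn_gt0.
Qed.

(** Since all members of the family vanish at 0, this identifies [expinv n.+1] as the difference
    quotient of [expinv n] at 0, the form required by the Caratheodory criterion. *)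
Lemma expinvS (R : realType) n (x : R) : expinv n x = expinv n.+1 x * x.
Proof.
rewrite /expinv; case: ifPn => x0; last by rewrite mul0r.
have xn0 : x != 0 by rewrite gt_eqF.
by rewrite exprS; field; rewrite xn0 expf_neq0.
Qed.

(* [exp (1/x) >= ((1/x)/(n+1))^(n+1)] beats the pole [x^-n]. *)
Lemma expinv_le (R : realType) n (x : R) : expinv n x <= n.+1%:R ^+ n.+1 * `|x|.
Proof.
rewrite /expinv; case: ifPn => x0; last by rewrite mulr_ge0// exprn_ge0.
have xn0 : x != 0 by rewrite gt_eqF.
have k0 : (0 : R) < n.+1%:R by rewrite ltr0n.
have : ((n.+1%:R * x)^-1) ^+ n.+1 <= expR (x^-1).
  have -> : x^-1 = n.+1%:R * (n.+1%:R * x)^-1.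
    by rewrite invfM mulrA divff ?mul1r// gt_eqF.
  rewrite expRM_natl lerXn2r// ?nnegrE ?expR_ge0//.
    by rewrite invr_ge0 mulr_ge0// ltW.
  by apply: le_trans (expR_ge1Dx _); rewrite lerDr.
rewrite exprVn -lef_pV2 ?posrE ?expR_gt0 ?invr_gt0 ?exprn_gt0 ?mulr_gt0//.
rewrite invrK -expRN => H.
rewrite gtr0_norm// mulrC ler_pdivrMr ?exprn_gt0//.
by rewrite (le_trans H)// exprMn -mulrA -exprS.
Qed.

Lemma continuous_at0_expinv (R : realType) n : {for (0:R), continuous (@expinv R n)}.
Proof.
apply/(@cvgrPdist_le _ _ _ _ (nbhs_filter (0:R))) => e e0.
pose C : R := n.+1%:R ^+ n.+1.
have C0 : 0 < C by rewrite exprn_gt0// ltr0n.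
near=> x.
rewrite (@expinv_le0 _ n 0 (lexx _)) sub0r normrN ger0_norm ?expinv_ge0// (le_trans (expinv_le _ _))//.
rewrite -/C mulrC -ler_pdivlMr//.
near: x.
have : 0 < e / C by rewrite divr_gt0.
by move=> /(@nbhs0_le R R); apply: filterS.
Unshelve. all: by end_near. Qed.

(** The exponent [n] is carried along so that the derivative of a member is a combination of
    members; smoothness of all orders then follows from one differentiation rule. *)
Lemma is_derive_expinv (R : realType) n (x : R) :
  is_derive x 1 (@expinv R n) (- n%:R * expinv n.+1 x + expinv n.+2 x).
Proof.
have [x0|x0|->] := ltgtP x 0; last 1 first.
- rewrite !expinv_le0// mulr0 addr0.
  apply/is_derive1_caratheodory; exists (expinv n.+1); split.
  + by move=> z; rewrite (@expinv_le0 _ _ 0)// !subr0 expinvS.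
  + exact: continuous_at0_expinv.
  + by rewrite expinv_le0.
- rewrite !expinv_le0 ?ltW// mulr0 addr0.
  apply: (@near_eq_is_derive _ _ _ (cst 0)).
  by near=> z; rewrite /= expinv_le0// ltW//; near: z; exact: lt_nbhsl.
- have xn0 : x != 0 by rewrite gt_eqF.
  have xe0 : (@id R ^+ n) x != 0 by rewrite exprfctE expf_neq0.
  have d1 := @is_deriveV _ (@id R ^+ n) x _ 1 xe0
    (@is_deriveX _ _ (@id R) n x 1 1 (is_derive_id x 1)).
  have dV := @is_deriveV _ (@id R) x 1 1 xn0 (is_derive_id x 1).
  have d2 := @is_derive1_comp _ expR _ x _ _ (is_derive_expR _)
    (@is_deriveN _ _ _ _ _ _ _ dV).
  have D := @is_deriveM _ _ _ _ _ _ _ _ d1 d2.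
  apply: near_eq_is_derive (is_derive_eq D _).
    near=> z; rewrite /expinv ifT ?fctE//.
    by near: z; exact: lt_nbhsr.
  rewrite !fctE /GRing.scale/= /expinv x0 !mulr1.
  case: n {d1 xe0 D} => [|n].
    by rewrite !expr0 /= mul0r mulr0 oppr0 mul0r add0r; field.
  by rewrite /= !exprS; field; rewrite xn0 expf_neq0.
Unshelve. all: by end_near. Qed.

(* Closed under differentiation by construction, hence a class of smooth
   functions; it contains cut-offs because it contains [expinv]. *)
Inductive flat_smooth {R : realType} : (R -> R) -> Prop :=
| FlatExp n : flat_smooth (expinv n)
| FlatCst c : flat_smooth (fun _ => c)
| FlatAdd f g : flat_smooth f -> flat_smooth g -> flat_smooth (fun x => f x + g x)
| FlatMul f g : flat_smooth f -> flat_smooth g -> flat_smooth (fun x => f x * g x)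
| FlatInv f : (forall x, f x != 0) -> flat_smooth f -> flat_smooth (fun x => (f x)^-1)
| FlatAff c d f : flat_smooth f -> flat_smooth (fun x => f (c * x + d)).

Lemma flat_smooth_derive (R : realType) (f : R -> R) : flat_smooth f ->
  exists2 g : R -> R, flat_smooth g & forall x : R, is_derive x 1 f (g x).
Proof.
elim=> {f} [n|c|f g sf [f' sf' df] sg [g' sg' dg]|f g sf [f' sf' df] sg [g' sg' dg]
  |f fn0 sf [f' sf' df]|c d f sf [f' sf' df]].
- exists (fun x => - n%:R * expinv n.+1 x + expinv n.+2 x).
    by do !constructor.
  exact: is_derive_expinv.
- by exists (fun _ => 0); [exact: FlatCst | move=> x; exact: is_derive_cst].
- exists (fun x => f' x + g' x); first exact: FlatAdd.
  by move=> x; exact: is_deriveD.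
- exists (fun x => f x * g' x + g x * f' x).
    by apply: FlatAdd; apply: FlatMul.
  by move=> x; exact: is_deriveM.
- exists (fun x => (-1 * ((f x)^-1 * (f x)^-1)) * f' x).
    apply: FlatMul => //; apply: FlatMul; first exact: FlatCst.
    by apply: FlatMul; exact: FlatInv.
  move=> x; apply: (is_derive_eq (is_deriveV (fn0 x) (df x))).
  by rewrite /GRing.scale/= mulN1r expr2 invfM.
- exists (fun x => f' (c * x + d) * c).
    by apply: FlatMul; [exact: FlatAff | exact: FlatCst].
  move=> x.
  have d1 : is_derive x 1 (fun x => c * x + d) c.
    apply: (is_derive_eq (@is_deriveD _ _ _ _ _ _ _ _ _
      (@is_deriveZ _ _ _ _ c _ _ _ (is_derive_id x 1)) (is_derive_cst d x 1))).
    by rewrite addr0 /GRing.scale/= mulr1.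
  exact: (@is_derive1_comp _ f _ _ _ _ (df _) d1).
Qed.

Lemma flat_smooth_derivable (R : realType) (f : R -> R) (x : R) : flat_smooth f -> derivable f x 1.
Proof. by move=> /flat_smooth_derive[g _ /(_ x) []]. Qed.

Lemma flat_smooth_continuous (R : realType) (f : R -> R) : flat_smooth f -> continuous f.
Proof.
by move=> sf x; apply/differentiable_continuous/derivable1_diffP/flat_smooth_derivable.
Qed.

Lemma flat_smooth_derive1 (R : realType) (f : R -> R) : flat_smooth f -> flat_smooth (derive1 f).
Proof.
move=> /flat_smooth_derive[g sg dg]; rewrite (_ : derive1 f = g)//.
by apply/funext => x; rewrite derive1E; exact: derive_val.
Qed.

Lemma flat_smooth_is_derive (R : realType) (f : R -> R) (x : R) : flat_smooth f ->
  is_derive x 1 f (derive1 f x).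
Proof. by move=> sf; apply: DeriveDef; [exact: flat_smooth_derivable|rewrite derive1E]. Qed.

(** A partial derivative of a product X(z) Y(t) is again such a product with factors in the class,
    so one induction on the list of derivatives covers every order. *)
Lemma flat_smooth2 (R : realType) (X Y : R -> R) : flat_smooth X -> flat_smooth Y ->
  smooth2 (fun z t => X z * Y t).
Proof.
move=> sX sY l.
have [X' [Y' [sX' sY' ->]]] : exists X' Y', [/\ flat_smooth X', flat_smooth Y'
    & pderivs l (fun z t => X z * Y t) = fun z t => X' z * Y' t].
  elim: l => [|b l [X' [Y' [sX' sY' /= ->]]]]; first by exists X, Y.
  case: b.
  - exists (derive1 X'), Y'; split => //; first exact: flat_smooth_derive1.
    apply/funext => z; apply/funext => t; rewrite derive1E.
    have H := @is_deriveM _ _ _ _ _ _ _ _ (flat_smooth_is_derive z sX')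
      (is_derive_cst (Y' t) z 1).
    by rewrite (@derive_val _ _ _ _ _ _ _ H) /GRing.scale/= mulr0 add0r mulrC.
  - exists X', (derive1 Y'); split => //; first exact: flat_smooth_derive1.
    apply/funext => z; apply/funext => t; rewrite derive1E.
    have H := @is_deriveM _ _ _ _ _ _ _ _ (is_derive_cst (X' z) t 1)
      (flat_smooth_is_derive t sY').
    by rewrite (@derive_val _ _ _ _ _ _ _ H) /GRing.scale/= mulr0 addr0.
split.
  move=> p; apply: (@cvgM _ _ _ _ (fun p => X' p.1) (fun p => Y' p.2)).
    apply: (@cvg_comp _ _ _ fst X'); first exact: cvg_fst.
    exact: flat_smooth_continuous.
  apply: (@cvg_comp _ _ _ snd Y'); first exact: cvg_snd.
  exact: flat_smooth_continuous.
move=> z t; split.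
  by apply: derivableM; [exact: flat_smooth_derivable | exact: derivable_cst].
by apply: derivableM; [exact: derivable_cst | exact: flat_smooth_derivable].
Qed.

Definition is_smooth_step {R : realType} (s : R -> R) (S : R) :=
  [/\ flat_smooth s, forall x, x <= 0 -> s x = 0, forall x, 1 <= x -> s x = 1,
      forall x, 0 <= s x <= 1 & forall x, `|derive1 s x| <= S].

Lemma near_cst_derive1 (R : realType) (f : R -> R) (c x : R) :
  (\near x, f x = c) -> derive1 f x = 0.
Proof.
move=> fc; rewrite derive1E -(@derive_cst _ R R c x 1).
exact: near_eq_derive.
Qed.

Lemma smooth_step_derive0 (R : realType) (s : R -> R) S x : is_smooth_step s S ->
  x < 0 \/ 1 < x -> derive1 s x = 0.
Proof.
move=> [_ s0 s1 _ _] [x0|x1].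
  apply: (@near_cst_derive1 _ _ 0); near=> y; apply: s0; apply: ltW.
  by near: y; exact: lt_nbhsl.
apply: (@near_cst_derive1 _ _ 1); near=> y; apply: s1; apply: ltW.
by near: y; exact: lt_nbhsr.
Unshelve. all: by end_near. Qed.

Lemma smooth_step_exists (R : realType) :
  exists s : R -> R, exists S : R, is_smooth_step s S.
Proof.
pose e := @expinv R 0.
have eP (x : R) : 0 < e x + e (-1 * x + 1).
  have [x0|x0] := ltP 0 x.
    by rewrite ltr_wpDr ?expinv_gt0 ?expinv_ge0.
  by rewrite ltr_wpDl ?expinv_ge0// expinv_gt0//; lra.
pose s x := e x * (e x + e (-1 * x + 1))^-1.
have ss : flat_smooth s.
  apply: FlatMul; first exact: FlatExp.
  apply: FlatInv; first by move=> x; rewrite gt_eqF.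
  by apply: FlatAdd; [|apply: FlatAff]; exact: FlatExp.
have s0 x : x <= 0 -> s x = 0 by move=> x0; rewrite /s /e expinv_le0// mul0r.
have s1 x : 1 <= x -> s x = 1.
  move=> x1; rewrite /s /e (@expinv_le0 _ _ (-1 * x + 1)); last lra.
  by rewrite addr0 divff// gt_eqF// expinv_gt0; lra.
have s01 x : 0 <= s x <= 1.
  rewrite divr_ge0 ?expinv_ge0 ?(ltW (eP x))//= ler_pdivrMr// mul1r.
  by rewrite lerDl expinv_ge0.
have cs' : continuous (fun x => `|derive1 s x|).
  move=> x; apply: cvg_norm.
  by apply: flat_smooth_continuous; exact: flat_smooth_derive1.
(* Beyond this interval [s] is locally constant, so the maximum over it bounds the derivative on the
   whole line; the margin around [0, 1] leaves room for those neighbourhoods. *)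
have [c c01 cM] := @EVT_max R (fun x => `|derive1 s x|) (-1) 2 ltac:(lra)
  (continuous_subspaceT cs').
exists s, `|derive1 s c|; split; [exact: ss | exact: s0 | exact: s1 | exact: s01 | move=> x].
have [x1|x1] := ltP x (-1).
  rewrite (@near_cst_derive1 _ _ 0) ?normr0//; near=> y; apply: s0.
  by have : y < -1; [near: y; exact: lt_nbhsl | lra].
have [x2|x2] := ltP 2 x.
  rewrite (@near_cst_derive1 _ _ 1) ?normr0//; near=> y; apply: s1.
  by have : 2 < y; [near: y; exact: lt_nbhsr | lra].
by apply: cM; rewrite in_itv/= x1.
Unshelve. all: by end_near. Qed.

Lemma derive1_flat_aff (R : realType) (s : R -> R) (c d x : R) : flat_smooth s ->
  derive1 (fun x => s (c * x + d)) x = c * derive1 s (c * x + d).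
Proof.
move=> ss.
have d1 : is_derive x 1 (fun x => c * x + d) c.
  apply: (is_derive_eq (@is_deriveD _ _ _ _ _ _ _ _ _
    (@is_deriveZ _ _ _ _ c _ _ _ (is_derive_id x 1)) (is_derive_cst d x 1))).
  by rewrite addr0 /GRing.scale/= mulr1.
have H := @is_derive1_comp _ s _ _ _ _ (flat_smooth_is_derive _ ss) d1.
by rewrite derive1E (@derive_val _ _ _ _ _ _ _ H) mulrC.
Qed.

(** * Measurability and integration on the line and the plane *)

Definition lip2 {R : realType} (L : R) (F : R -> R -> R) :=
  forall z z' t t', `|F z t - F z' t'| <= L * (`|z - z'| + `|t - t'|).

(** A Lipschitz function is the infimum of the cones of slope [L] standing on its graph over
    rational points. Its strict sublevel sets are therefore countable unions of sublevel sets of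
    explicit functions, measurable for the product sigma-algebra. *)
Lemma lip2_measurable (R : realType) (L : R) F : 0 <= L -> lip2 L F ->
  measurable_fun [set: R * R] (fun p : R * R => F p.1 p.2).
Proof.
move=> L0 FL; apply: (measurability _ (measurable_realfun.RGenInftyO.measurableE R)) => //.
move=> /= _ [_ [c ->] <-]; rewrite setTI preimage_itvNyo.
rewrite (_ : [set _ | _] = \bigcup_(q in [set: rat * rat]) [set p : R * R |
    F (ratr q.1) (ratr q.2) + L * (`|p.1 - ratr q.1| + `|p.2 - ratr q.2|) < c]).
  apply: countable_bigcupT_measurable; first exact: countableP.
  move=> q; rewrite -[X in measurable X]setTI.
  rewrite (_ : [set p | _] = (fun p : R * R => F (ratr q.1) (ratr q.2) + 
    L * (`|p.1 - ratr q.1| + `|p.2 - ratr q.2|)) @^-1` `]-oo, c[); last first.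
    by rewrite preimage_itvNyo.
  suff /(_ measurableT) : measurable_fun [set: R * R] (fun p : R * R => F (ratr q.1) (ratr q.2) +
    L * (`|p.1 - ratr q.1| + `|p.2 - ratr q.2|)) by exact.
  apply: measurable_funD => //; apply: measurable_funM => //.
  apply: measurable_funD; apply: measurableT_comp => //; apply: measurable_funB => //.
apply/seteqP; split => -[z t] /=; last first.
  move=> [[q r] _ /=]; apply: le_lt_trans.
  by have := FL z (ratr q) t (ratr r); rewrite ler_norml => /andP[_]; lra.
move=> Fc.
(* Over a rational point within [e] in each coordinate, the vertex exceeds [F z t] by at most
   [2 * L * e] and the cone adds another [2 * L * e]; [L + 1] keeps the divisor positive when
   [L = 0]. *)
pose e := (c - F z t) / (4 * (L + 1)).
have e0 : 0 < e by rewrite divr_gt0 ?subr_gt0// mulr_gt0//; lra.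
have Le : 4 * (L * e) < c - F z t.
  have -> : c - F z t = 4 * (L + 1) * e by rewrite /e; field; lra.
  nra.
have [q] := @rat_in_itvoo R (z - e) (z + e) ltac:(lra).
rewrite in_itv/= => /andP[q1 q2].
have [r] := @rat_in_itvoo R (t - e) (t + e) ltac:(lra).
rewrite in_itv/= => /andP[r1 r2].
exists (q, r) => //=.
have zq : `|z - ratr q| <= e by rewrite ler_norml; lra.
have tr : `|t - ratr r| <= e by rewrite ler_norml; lra.
have H1 := FL (ratr q) z (ratr r) t.
rewrite distrC (distrC (ratr q)) (distrC (ratr r)) in H1.
move: H1; rewrite ler_norml => /andP[H1 _].
have H2 : L * (`|z - ratr q| + `|t - ratr r|) <= L * (e + e).
  by rewrite ler_wpM2l// lerD.
lra.
Qed.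


Lemma preimage_affine_itv (R : realType) (c d a b : R) : 0 < c ->
  (fun x : R => c * x + d) @^-1` `]a, b] = `](a - d) / c, (b - d) / c]%classic.
Proof.
move=> c0; apply/seteqP; split => x /=; rewrite !in_itv/=.
  by rewrite ltr_pdivrMr// ler_pdivlMr// => /andP[? ?]; apply/andP; split; lra.
by rewrite ltr_pdivrMr// ler_pdivlMr// => /andP[? ?]; apply/andP; split; lra.
Qed.

(** The pushforward of Lebesgue measure under the affine map, multiplied by [c], agrees with
    Lebesgue measure on half-open intervals and hence everywhere by uniqueness; the formula is then
    integration against a pushforward. *)
Lemma ge0_integral_affine (R : realType) (c d : R) (h : R -> \bar R) : 0 < c ->
  measurable_fun [set: R] h -> (forall x, 0 <= h x)%E ->
  (\int[lebesgue_measure]_x h (c * x + d)%R =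
   c^-1%:E * \int[lebesgue_measure]_x h x)%E.
Proof.
move=> c0 mh h0.
pose phi (x : measurableTypeR R) : measurableTypeR R := c * x + d.
have mphi : measurable_fun setT phi by apply: measurable_funD => //; exact: measurable_funM.
pose pf : {measure set (measurableTypeR R) -> \bar R} :=
  measure_function_pushforward__canonical__measure_function_Measure lebesgue_measure mphi.
pose nu := mscale (NngNum (ltW c0)) pf.
have E A : measurable A -> lebesgue_measure A = nu A.
  move=> mA; apply: lebesgue_measure_unique => //= _ [[a b]] _ <-.
  rewrite /nu/= /mscale/= /pushforward/= preimage_affine_itv//.
  rewrite !lebesgue_measure_itv/= !lte_fin ltr_pM2r ?invr_gt0// ltrD2r.
  case: ifPn => _; last by rewrite mule0.
  by rewrite -!EFinD -EFinM; congr EFin; field; rewrite gt_eqF.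
have -> : (\int[lebesgue_measure]_x h x = \int[nu]_x h x)%E.
  by apply: eq_measure_integral => A mA _; exact: E.
rewrite ge0_integral_mscale//= ge0_integral_pushforward//= preimage_setT.
by rewrite muleA -EFinM mulVf ?gt_eqF// mul1e.
Qed.

Lemma ge0_integral_shift (R : realType) (d : R) (h : R -> \bar R) :
  measurable_fun [set: R] h -> (forall x, 0 <= h x)%E ->
  (\int[lebesgue_measure]_x h (x + d)%R = \int[lebesgue_measure]_x h x)%E.
Proof.
move=> mh h0; have := @ge0_integral_affine R 1 d h ltr01 mh h0.
by rewrite invr1 mul1e => <-; apply: eq_integral => x _; rewrite mul1r.
Qed.

Lemma integrable_shift (R : realType) (d : R) (h : R -> R) :
  lebesgue_measure.-integrable [set: R] (EFin \o h) ->
  lebesgue_measure.-integrable [set: R] (fun x => (h (x + d))%:E).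
Proof.
move=> /integrableP[mh ih]; apply/integrableP; split.
  apply: (measurableT_comp mh); exact: measurable_funD.
rewrite (ge0_integral_shift d (h := fun x => `|(EFin \o h) x|%E))//.
exact: measurableT_comp.
Qed.

Lemma Rintegral_shift (R : realType) (d : R) (h : R -> R) :
  lebesgue_measure.-integrable [set: R] (EFin \o h) ->
  \int[lebesgue_measure]_x h (x + d) = \int[lebesgue_measure]_x h x.
Proof.
move=> ih; have mh := measurable_int _ ih.
rewrite /Rintegral integralE [in RHS]integralE.
have mp := measurable_funepos mh; have mn := measurable_funeneg mh.
rewrite -(ge0_integral_shift d mp); last by [].
rewrite -(ge0_integral_shift d mn); last by [].
by congr (fine (_ - _)%E); apply: eq_integral => x _; rewrite ?funeposE ?funenegE.
Qed.

Lemma dominated_integrable d (T : measurableType d) (R : realType)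
    (mu : {measure set T -> \bar R}) (D : set T) (f g : T -> R) : measurable D ->
  measurable_fun D f -> (forall x, D x -> `|f x| <= g x) ->
  mu.-integrable D (EFin \o g) -> mu.-integrable D (EFin \o f).
Proof.
move=> mD mf fg; apply: le_integrable => //; first exact/measurable_EFinP.
by move=> x Dx; rewrite /= lee_fin (le_trans (fg x Dx))// ler_norm.
Qed.

Lemma norm_Rintegral_le d (T : measurableType d) (R : realType)
    (mu : {measure set T -> \bar R}) (D : set T) (f g : T -> R) : measurable D ->
  measurable_fun D f -> (forall x, D x -> `|f x| <= g x) ->
  mu.-integrable D (EFin \o g) ->
  `|\int[mu]_(x in D) f x| <= \int[mu]_(x in D) g x.
Proof.
move=> mD mf fg ig.
apply: (le_trans (le_normr_Rintegral mD (dominated_integrable mD mf fg ig))).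
apply: le_Rintegral => //.
apply: (@dominated_integrable _ _ _ _ _ _ g) => //; first exact: measurableT_comp.
by move=> x Dx; rewrite normr_id fg.
Qed.

Lemma integrable_scale d (T : measurableType d) (R : realType)
    (mu : {measure set T -> \bar R}) (D : set T) (c : R) (f : T -> R) : measurable D ->
  mu.-integrable D (EFin \o f) -> mu.-integrable D (EFin \o (fun x => c * f x)).
Proof.
move=> mD fi; rewrite (_ : EFin \o _ = (fun x => c%:E * (EFin \o f) x)%E).
  exact: integrableZl.
by apply/funext => x /=; rewrite EFinM.
Qed.

Lemma integrable_add d (T : measurableType d) (R : realType)
    (mu : {measure set T -> \bar R}) (D : set T) (f g : T -> R) : measurable D ->
  mu.-integrable D (EFin \o f) -> mu.-integrable D (EFin \o g) ->
  mu.-integrable D (EFin \o (fun x => f x + g x)).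
Proof.
move=> mD fi gi; rewrite (_ : EFin \o _ = (EFin \o f) \+ (EFin \o g))%E.
  exact: integrableD.
by apply/funext => x /=; rewrite EFinD.
Qed.

Lemma integrable_sub d (T : measurableType d) (R : realType)
    (mu : {measure set T -> \bar R}) (D : set T) (f g : T -> R) : measurable D ->
  mu.-integrable D (EFin \o f) -> mu.-integrable D (EFin \o g) ->
  mu.-integrable D (EFin \o (fun x => f x - g x)).
Proof.
move=> mD fi gi; rewrite (_ : EFin \o _ = (EFin \o f) \- (EFin \o g))%E.
  exact: integrableB.
by apply/funext => x /=; rewrite EFinB.
Qed.

Lemma leb_dominated (R : realType) (f g : R -> R) :
  measurable_fun [set: R] f -> (forall x, `|f x| <= g x) ->
  leb.-integrable [set: R] (EFin \o g) -> leb.-integrable [set: R] (EFin \o f).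
Proof. by move=> mf fg; apply: dominated_integrable => // x _. Qed.

Lemma leb_norm_le (R : realType) (f g : R -> R) :
  measurable_fun [set: R] f -> (forall x, `|f x| <= g x) ->
  leb.-integrable [set: R] (EFin \o g) ->
  `|\int[leb]_x f x| <= \int[leb]_x g x.
Proof. by move=> mf fg; apply: norm_Rintegral_le => // x _. Qed.

(** * Testing the weak formulation with smoothed slabs *)

Lemma lip2_measurable1 (R : realType) (L : R) F t : 0 <= L -> lip2 L F ->
  measurable_fun [set: R] (fun z => F z t).
Proof.
move=> L0 FL; exact: (measurableT_comp (lip2_measurable L0 FL) (pair2_measurable t)).
Qed.

Lemma lip2_measurable2 (R : realType) (L : R) F z : 0 <= L -> lip2 L F ->
  measurable_fun [set: R] (fun t => F z t).
Proof.
move=> L0 FL; exact: (measurableT_comp (lip2_measurable L0 FL) (pair1_measurable z)).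
Qed.

Lemma integrable_indicM (R : realType) (a b C : R) : a <= b ->
  lebesgue_measure.-integrable [set: R] (EFin \o (fun x => C * \1_(`[a, b]%classic) x)).
Proof.
move=> ab; apply: integrable_scale => //.
exact: (integrable_indic_itv a b true false).
Qed.

Lemma Rintegral_indicM (R : realType) (a b C : R) : a <= b ->
  \int[lebesgue_measure]_x (C * \1_(`[a, b]%classic : set R) x) = C * (b - a).
Proof.
move=> ab; rewrite RintegralZl//; last exact: (integrable_indic_itv a b true false).
rewrite /Rintegral integral_indic// setIT.
rewrite /= lebesgue_measure_itv/= lte_fin.
have [//|ba] := ltP a b.
by rewrite (_ : b = a) ?subrr//; apply: le_anti; rewrite ab ba.
Qed.

Lemma Rintegral_bump (R : realType) (s : R -> R) (S e : R) : 0 < e -> is_smooth_step s S ->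
  \int[lebesgue_measure]_x (e^-1 * derive1 s (e^-1 * x)) = 1.
Proof.
move=> e0 sS; have [ss s0 s1 s01 s'S] := sS.
pose F x := s (e^-1 * x + 0).
have sF : flat_smooth F by exact: FlatAff.
have F'E x : derive1 F x = e^-1 * derive1 s (e^-1 * x).
  by rewrite derive1_flat_aff// addr0.
have cF' : continuous (derive1 F) by apply/flat_smooth_continuous/flat_smooth_derive1.
under eq_Rintegral do rewrite -F'E.
have -> : derive1 F = (derive1 F) \_ `[0, e].
  apply/funext => x; rewrite patchE; case: ifPn => //.
  rewrite notin_setE/= in_itv/= => /negP xe.
  rewrite F'E (smooth_step_derive0 sS) ?mulr0//.
  move: xe; rewrite negb_and -!ltNge => /orP[x0|ex].
    by left; rewrite pmulr_rlt0// invr_gt0.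
  by right; rewrite mulrC ltr_pdivlMr// mul1r.
rewrite -Rintegral_mkcond /Rintegral.
rewrite (@continuous_FTC2 _ _ F)//.
- by rewrite /= /F mulr0 addr0 mulVf ?gt_eqF// addr0 s1// s0// subr0.
- exact: continuous_subspaceT.
- have cF := flat_smooth_continuous sF.
  split.
  + by move=> x _; exact: flat_smooth_derivable.
  + by apply: cvg_at_right_filter; exact: cF.
  + by apply: cvg_at_left_filter; exact: cF.
Qed.

(** The rescaled derivative of the step is an approximate identity supported in [[a, a + e]]. Its
    sign is not known, so the error comes from the bound [S / e] on an interval of length [e],
    whence the factor [S]. *)
Lemma bump_avg (R : realType) (s : R -> R) (S e a L : R) (h : R -> R) : 0 < e -> 0 <= L ->
  is_smooth_step s S -> measurable_fun [set: R] h ->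
  (forall z, `|h z - h a| <= L * `|z - a|) ->
  let k z := h z * (e^-1 * derive1 s (e^-1 * (z - a))) in
  lebesgue_measure.-integrable [set: R] (EFin \o k) /\
  `|\int[lebesgue_measure]_z k z - h a| <= L * S * e.
Proof.
move=> e0 L0 sS mh hL k; have [ss s0 s1 s01 s'S] := sS.
have S0 : 0 <= S by exact: le_trans (s'S 0).
pose q z := e^-1 * derive1 s (e^-1 * (z - a)).
have m1 : measurable_fun [set: R] (derive1 s).
  by apply: continuous_measurable_fun; apply: flat_smooth_continuous; exact: flat_smooth_derive1.
have m2 : measurable_fun [set: R] (fun z => e^-1 * (z - a)).
  by apply: measurable_funM => //; exact: measurable_funB.
have mq : measurable_fun [set: R] q.
  by apply: measurable_funM => //; exact: (measurableT_comp m1 m2).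
have q0 z : ~~ (a <= z <= a + e) -> q z = 0.
  rewrite negb_and -!ltNge /q => H; rewrite (smooth_step_derive0 sS) ?mulr0//.
  case/orP: H => H.
    by left; rewrite pmulr_rlt0 ?invr_gt0// subr_lt0.
  by right; rewrite mulrC ltr_pdivlMr// mul1r; lra.
have qS z : `|q z| <= S / e.
  by rewrite /q normrM gtr0_norm ?invr_gt0// mulrC ler_wpM2r// invr_ge0 ltW.
have q1 z : `|q z| <= S / e * \1_`[a, a + e] z.
  rewrite indicE; have [az|az] := boolP (a <= z <= a + e).
    by rewrite mem_set ?mulr1//= in_itv/= az.
  by rewrite q0// normr0 mulr_ge0// divr_ge0// ltW.
have iq : lebesgue_measure.-integrable [set: R] (EFin \o q).
  apply: (leb_dominated mq q1).
  by apply: integrable_indicM; lra.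
have d1 z : `|(h z - h a) * q z| <= L * S * \1_`[a, a + e] z.
  rewrite indicE; have [az|az] := boolP (a <= z <= a + e).
    rewrite mem_set ?mulr1//= ?in_itv/= ?az// normrM.
    have -> : L * S = (L * e) * (S / e) by field; rewrite gt_eqF.
    rewrite ler_pM//; apply: (le_trans (hL z)); rewrite ler_wpM2l//.
    by rewrite ler_norml; lra.
  by rewrite q0// mulr0 normr0 mulr_ge0// mulr_ge0.
have md : measurable_fun [set: R] (fun z => (h z - h a) * q z).
  by apply: measurable_funM => //; exact: measurable_funB.
have ii : lebesgue_measure.-integrable [set: R]
    (EFin \o (fun z => L * S * \1_`[a, a + e] z)).
  by apply: integrable_indicM; lra.
have id := leb_dominated md d1 ii.
have iha : lebesgue_measure.-integrable [set: R] (EFin \o (fun z => h a * q z)).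
  exact: integrable_scale.
have kE : k = (fun z => (h z - h a) * q z + h a * q z).
  by apply/funext => z; rewrite /k -/(q z); ring.
split.
  by rewrite kE; exact: integrable_add.
rewrite kE RintegralD// RintegralZl//.
have -> : \int[lebesgue_measure]_x q x = 1.
  rewrite -(Rintegral_bump e0 sS) -(@Rintegral_shift _ a q iq).
  by apply: eq_Rintegral => x _; rewrite /q addrK.
rewrite mulr1 addrK.
apply: (le_trans (leb_norm_le md d1 ii)).
by rewrite Rintegral_indicM; lra.
Qed.

(** The ramps occupy [[a, a + e]] and [[b, b + e]]. Subtraction is spelled with [-1 *] and affine
    arguments as [c * z + d] so that the constructors of [flat_smooth] apply as they stand. *)
Definition plateau {R : realType} (s : R -> R) (e a b z : R) :=
  s (e^-1 * z + - (e^-1 * a)) + -1 * s (e^-1 * z + - (e^-1 * b)).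

Lemma flat_smooth_plateau (R : realType) (s : R -> R) (e a b : R) :
  flat_smooth s -> flat_smooth (plateau s e a b).
Proof.
move=> ss; apply: FlatAdd; first exact: FlatAff.
by apply: FlatMul; [exact: FlatCst | exact: FlatAff].
Qed.

Lemma derive1_plateau (R : realType) (s : R -> R) (e a b z : R) : flat_smooth s ->
  derive1 (plateau s e a b) z =
  e^-1 * derive1 s (e^-1 * (z - a)) - e^-1 * derive1 s (e^-1 * (z - b)).
Proof.
move=> ss.
have da := @is_deriveD _ _ _ _ _ _ _ _ _
  (flat_smooth_is_derive z (FlatAff e^-1 (- (e^-1 * a)) ss))
  (@is_deriveZ _ _ _ _ (-1) _ _ _ (flat_smooth_is_derive z (FlatAff e^-1 (- (e^-1 * b)) ss))).
rewrite derive1E (_ : plateau s e a b = (fun x : R => s (e^-1 * x + - (e^-1 * a))) +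
   (-1 \*: (fun x : R => s (e^-1 * x + - (e^-1 * b)))))//.
rewrite (@derive_val _ _ _ _ _ _ _ da) !derive1_flat_aff// !mulrBr /GRing.scale/=.
by rewrite mulN1r.
Qed.

(* Only times in [0, T] enter the weak formulation, and there the second factor is 1. *)
Lemma plateau_test_fun (R : realType) (s : R -> R) (S e a b T : R) : 0 < e -> a < b -> 0 < T ->
  is_smooth_step s S ->
  test_fun (fun z t => plateau s e a b z * plateau s 1 (-2) (T + 1) t).
Proof.
move=> e0 ab T0 [ss s0 s1 s01 s'S]; split.
  by apply: flat_smooth2; exact: flat_smooth_plateau.
have P0 (c a' b' x : R) : 0 < c -> a' <= b' -> x <= a' \/ b' + c <= x -> plateau s c a' b' x = 0.
  move=> c0 ab' [xa|bx].
    rewrite /plateau -!mulrBr s0 ?s0 ?mulr0 ?addr0// mulrC pmulr_lle0 ?invr_gt0//; lra.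
  rewrite /plateau -!mulrBr s1 ?s1 ?mulr1 ?subrr// mulrC ler_pdivlMr//; lra.
exists (`|a| + `|b| + e + T + 3) => z t H.
have := ler_norm a; have := ler_norm b; have := ler_norm (- a); have := ler_norm (- b).
rewrite !normrN => ? ? ? ?.
have ? := normr_ge0 a; have ? := normr_ge0 b.
case: H => H.
  rewrite (P0 e) ?mul0r ?(ltW ab)//.
  have [z0|z0] := leP 0 z; [right; rewrite (ger0_norm z0) in H| left; rewrite (ltr0_norm z0) in H]; lra.
rewrite (P0 1 (-2)) ?mulr0//; first lra.
have [z0|z0] := leP 0 t; [right; rewrite (ger0_norm z0) in H| left; rewrite (ltr0_norm z0) in H]; lra.
Qed.

(** Off the ramps the two functions coincide. No smallness of [e] relative to [b - a] is assumed:
    overlapping ramps are covered because both indicators are counted. *)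
Lemma plateau_indic (R : realType) (s : R -> R) (S e a b z : R) : 0 < e -> a < b ->
  is_smooth_step s S ->
  `|plateau s e a b z - \1_`[a, b] z| <= \1_`[a, a + e] z + \1_`[b, b + e] z.
Proof.
move=> e0 ab [ss s0 s1 s01 s'S].
have lo (c : R) : z <= c -> s (e^-1 * z + - (e^-1 * c)) = 0.
  by move=> zc; rewrite -mulrBr s0// mulrC pmulr_lle0 ?invr_gt0//; lra.
have hi (c : R) : c + e <= z -> s (e^-1 * z + - (e^-1 * c)) = 1.
  by move=> zc; rewrite -mulrBr s1// mulrC ler_pdivlMr//; lra.
have iE (c d : R) : (\1_`[c, d] z : R) = if c <= z <= d then 1 else 0.
  rewrite indicE; case: ifPn => H; first by rewrite mem_set//= in_itv/= H.
  by rewrite memNset//= in_itv/=; exact/negP.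
rewrite !iE /plateau.
have /andP[A1 A2] := s01 (e^-1 * z + - (e^-1 * a)).
have /andP[B1 B2] := s01 (e^-1 * z + - (e^-1 * b)).
rewrite ler_norml.
have [za|za] := ltP z a.
  by rewrite !lo ?(ltW za) ?(ltW (lt_trans za ab))//= [b <= z]leNgt (lt_trans za ab)/=; lra.
have [zae|zae] := leP z (a + e) => /=.
  have [zb|zb] := leP z b; have [bz|bz] := leP b z => /=; first by rewrite (lo b)//; case: ifP; lra.
  - by rewrite (lo b)//; lra.
  - by rewrite ifT; lra.
  - lra.
rewrite (hi a); last lra.
have [zb|zb] := leP z b; have [bz|bz] := leP b z => /=.
- by rewrite (lo b)//; case: ifP; lra.
- by rewrite (lo b)//; lra.
- have [zbe|zbe] := leP z (b + e); first lra.
  by rewrite (hi b); lra.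
- lra.
Qed.

(** The cutoff rises on [-2, -1] and falls on [T + 1, T + 2]. It is thus constant on an open
    neighbourhood of [0, T], which makes its derivative vanish at the end points as well. *)
Lemma plateau_eq1 (R : realType) (s : R -> R) S (T t : R) : is_smooth_step s S ->
  0 <= t <= T -> plateau s 1 (-2) (T + 1) t = 1 /\ derive1 (plateau s 1 (-2) (T + 1)) t = 0.
Proof.
move=> [ss s0 s1 s01 s'S] /andP[t0 tT].
have P (y : R) : -1 < y < T + 1 -> plateau s 1 (-2) (T + 1) y = 1.
  move=> /andP[y0 yT]; rewrite /plateau s1 ?s0 ?mulr0 ?addr0// invr1; lra.
split; first by apply: P; lra.
apply: (@near_cst_derive1 _ _ 1); near=> y; apply: P; apply/andP; split.
  by near: y; apply: lt_nbhsr; lra.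
by near: y; apply: lt_nbhsl; lra.
Unshelve. all: by end_near. Qed.

Lemma Rintegral_prod2 (R : realType) (f : R * R -> R) :
  (leb \x leb)%E.-integrable [set: R * R] (EFin \o f) ->
  (forall t, leb.-integrable [set: R] (EFin \o (fun z => f (z, t)))) ->
  measurable_fun [set: R] (fun t => \int[leb]_z f (z, t)) /\
  \int[(leb \x leb)%E]_p f p = \int[leb]_t \int[leb]_z f (z, t).
Proof.
move=> fi fi1.
have E t : (\int[leb]_z (f (z, t))%:E = (\int[leb]_z f (z, t))%:E)%E.
  by rewrite /Rintegral fineK//; exact: (integrable_fin_num measurableT (fi1 t)).
split.
  apply/measurable_EFinP; rewrite (_ : EFin \o _ = fubini_G leb (EFin \o f)).
    exact: (measurable_fubini_G fi).
  by apply/funext => t; rewrite /= -E.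
rewrite [LHS]/Rintegral -(integral21_prod_meas1 fi); congr fine.
by apply: eq_integral => t _; rewrite -E.
Qed.

Lemma integrable_box (R : realType) (C a b c d : R) : (leb \x leb)%E.-integrable [set: R * R]
  (EFin \o (fun p => C * \1_(`[a, b]%classic `*` `[c, d]%classic) p)).
Proof.
apply: integrable_scale => //.
have mA : measurable (`[a, b]%classic `*` `[c, d]%classic : set (R * R)).
  exact: measurableX.
apply/integrableP; split; first by apply/measurable_EFinP; exact: measurable_indic.
under eq_integral do rewrite /= ger0_norm//.
rewrite integral_indic// setIT /= product_measure1E//=.
rewrite !lebesgue_measure_itv/= !lte_fin.
by case: ifP => _; case: ifP => _; rewrite ?mule0 ?mul0e// -!EFinD -EFinM ltry.
Qed.

Lemma derive1_cstM (R : realType) (Y : R -> R) (c t : R) : flat_smooth Y ->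
  derive1 (fun t => c * Y t) t = c * derive1 Y t.
Proof.
move=> sY; have H := @is_deriveZ _ _ _ _ c _ _ _ (flat_smooth_is_derive t sY).
by rewrite derive1E (@derive_val _ _ _ _ _ _ _ H).
Qed.

Lemma leb2_dominated (R : realType) (f g : R * R -> R) :
  measurable_fun [set: R * R] f -> (forall x, `|f x| <= g x) ->
  (leb \x leb)%E.-integrable [set: R * R] (EFin \o g) ->
  (leb \x leb)%E.-integrable [set: R * R] (EFin \o f).
Proof. by move=> mf fg; apply: dominated_integrable => // x _. Qed.

Lemma small_multiple_eq (R : realType) (C x y : R) :
  (forall e, 0 < e -> `|x - y| <= C * e) -> x = y.
Proof.
move=> H; apply/eqP; rewrite -subr_eq0 -normr_le0.
apply/ler_addgt0Pr => d d0; rewrite add0r.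
have C1 : 0 < `|C| + 1 by rewrite ltr_wpDl.
apply: (le_trans (H (d / (`|C| + 1)) _)); first by rewrite divr_gt0.
rewrite mulrCA ger_pMr// ler_pdivrMr// mul1r.
by rewrite (le_trans (ler_norm _))// lerDl.
Qed.

Lemma norm_sub_sub_le (R : realType) (x y p q k : R) : `|x - p| <= k -> `|y - q| <= k ->
  `|- (x - y) - (q - p)| <= 2 * k.
Proof. by rewrite !ler_norml => /andP[? ?] /andP[? ?]; lra. Qed.

(** With a time factor equal to 1 on [0, T], only the space derivative of the test function
    survives: a bump at [a] minus a bump at [b]. As [e] tends to 0 these evaluate [B] at the two
    ends, while the boundary terms in time see the indicator of [[a, b]]. *)
Lemma slab_identity (R : realType) (w B : R -> R -> R) (w0 : R -> R) (L M T a b : R) :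
  0 <= L -> lip2 L w -> lip2 L B -> (forall z t, `|w z t| <= M) -> (forall z t, `|B z t| <= M) ->
  measurable_fun [set: R] w0 -> (forall z, `|w0 z| <= M) ->
  0 < T -> a < b ->
  (forall phi : R -> R -> R, test_fun phi ->
    Rintegral (leb \x leb)%E ([set: R] `*` `[(0:R), T]%classic)
      (fun p : R * R => w p.1 p.2 * derive1 (fun t' => phi p.1 t') p.2
         - B p.1 p.2 * derive1 (fun z' => phi z' p.2) p.1)
    = Rintegral leb [set: R] (fun z => w z T * phi z T - w0 z * phi z 0)) ->
  \int[leb]_(z in `[a, b]) (w z T - w0 z) = \int[leb]_(t in `[0, T]) (B b t - B a t).
Proof.
move=> L0 Lw LB wM BM mw0 w0M T0 ab weak.
have [s [S sS]] := smooth_step_exists R.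
have [ss s0 s1 s01 s'S] := sS.
have S0 : 0 <= S by exact: le_trans (s'S 0).
have M0 : 0 <= M by exact: le_trans (wM 0 0).
have mwT := lip2_measurable1 T L0 Lw.
pose g z := w z T - w0 z.
have mg : measurable_fun [set: R] g by exact: measurable_funB.
have gM z : `|g z| <= 2 * M.
  by apply: (le_trans (ler_normB _ _)); have := wM z T; have := w0M z; lra.
have mBt c : measurable_fun [set: R] (fun t => B c t) by exact: lip2_measurable2 L0 LB.
have mBz t : measurable_fun [set: R] (fun z => B z t) by exact: lip2_measurable1 L0 LB.
have iT : leb.-integrable [set: R] (EFin \o (\1_(`[0, T]%classic : set R) : R -> R)).
  exact: (integrable_indic_itv 0 T true false).
pose D t := (B b t - B a t) * \1_(`[0, T]%classic : set R) t.
have mD : measurable_fun [set: R] D.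
  by apply: measurable_funM; [exact: measurable_funB | exact: measurable_indic].
have D1 t : `|D t| <= 2 * M * \1_(`[0, T]%classic : set R) t.
  rewrite normrM ler_pM//; last by rewrite ger0_norm// indicE ler0n.
  by apply: (le_trans (ler_normB _ _)); have := BM b t; have := BM a t; lra.
have iD := leb_dominated mD D1 (integrable_scale (2 * M) measurableT iT).
have restr (A : set R) (f : R -> R) : \int[leb]_(x in A) f x = \int[leb]_x (f x * \1_A x).
  by rewrite Rintegral_mkcond; apply: eq_Rintegral => x _; rewrite patchE indicE; case: (_ \in _); rewrite ?mulr1 ?mulr0.
rewrite [RHS]restr -/(D _) [LHS]restr -/(g _).
(* Each of the two bumps costs [L * S * e] at every time in [0, T]; each of the two ramps has length
   [e] and meets a function bounded by [2 * M]. *)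
apply: (@small_multiple_eq _ (2 * L * S * T + 4 * M)) => e e0.
pose X := plateau s e a b; pose Y := plateau s 1 (-2) (T + 1).
have sX : flat_smooth X by exact: flat_smooth_plateau.
have X'E z : derive1 X z = e^-1 * derive1 s (e^-1 * (z - a)) - e^-1 * derive1 s (e^-1 * (z - b)).
  exact: derive1_plateau.
have mX : measurable_fun [set: R] X.
  by apply: continuous_measurable_fun; exact: flat_smooth_continuous.
have mX' : measurable_fun [set: R] (derive1 X).
  by apply: continuous_measurable_fun; apply: flat_smooth_continuous; exact: flat_smooth_derive1.
(* Extension by 0 outside the time window turns the integral into one over the whole plane, the
   setting of the Fubini lemma. *)
pose f (p : R * R) := - (B p.1 p.2 * derive1 X p.1) * \1_(`[0, T]%classic : set R) p.2.
have weakL : Rintegral (leb \x leb)%E ([set: R] `*` `[(0:R), T]%classic)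
      (fun p : R * R => w p.1 p.2 * derive1 (fun t' => X p.1 * Y t') p.2
         - B p.1 p.2 * derive1 (fun z' => X z' * Y p.2) p.1) = \int[(leb \x leb)%E]_p f p.
  rewrite [LHS]Rintegral_mkcond; congr (Rintegral _ _ _); apply/funext; case=> z t.
  rewrite patchE /f indicE /=.
  have [t0T|t0T] := boolP (t \in `[0, T]%classic).
    rewrite ifT; last by rewrite in_setX in_setT.
    have [Y1 Y'0] : Y t = 1 /\ derive1 Y t = 0.
      by apply: (plateau_eq1 sS); move: t0T; rewrite inE/= in_itv.
    rewrite derive1_cstM; last exact: flat_smooth_plateau.
    rewrite Y'0 Y1 !mulr0 add0r mulr1.
    by rewrite (_ : (fun z' : R => X z' * 1) = X)//; apply/funext => y; rewrite mulr1.
  rewrite ifF ?mulr0//.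
  by rewrite in_setX in_setT (negbTE t0T).
have weakR : Rintegral leb [set: R] (fun z => w z T * (X z * Y T) - w0 z * (X z * Y 0)) =
    \int[leb]_z (g z * X z).
  have [YT _] : Y T = 1 /\ derive1 Y T = 0 by apply: (plateau_eq1 sS); rewrite ltW/=.
  have [Y0 _] : Y 0 = 1 /\ derive1 Y 0 = 0 by apply: (plateau_eq1 sS); rewrite lexx ltW.
  by apply: eq_Rintegral => z _; rewrite YT Y0 !mulr1 mulrBl.
have := weak _ (plateau_test_fun e0 ab T0 sS).
rewrite weakL weakR => fgX.
have X'0 z : ~~ (a <= z <= b + e) -> derive1 X z = 0.
  rewrite negb_and -!ltNge X'E => H; rewrite !(smooth_step_derive0 sS) ?mulr0 ?subrr//.
    case/orP: H => H; first by left; rewrite pmulr_rlt0 ?invr_gt0//; lra.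
    by right; rewrite mulrC ltr_pdivlMr//; lra.
  case/orP: H => H; first by left; rewrite pmulr_rlt0 ?invr_gt0//; lra.
  by right; rewrite mulrC ltr_pdivlMr//; lra.
have X'1 z : `|derive1 X z| <= 2 * S / e.
  have bnd c : `|e^-1 * derive1 s (e^-1 * (z - c))| <= S / e.
    by rewrite normrM gtr0_norm ?invr_gt0// mulrC ler_wpM2r// invr_ge0 ltW.
  rewrite X'E (le_trans (ler_normB _ _))//.
  by have := bnd a; have := bnd b; lra.
have mf : measurable_fun [set: R * R] f.
  apply: measurable_funM.
    apply: measurable_funN; apply: measurable_funM; first exact: lip2_measurable L0 LB.
    exact: (measurableT_comp mX' measurable_fst).
  have mi : measurable_fun [set: R] (\1_(`[0, T]%classic : set R) : R -> R).
    exact: measurable_indic.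
  exact: (measurableT_comp mi measurable_snd).
have f1 p :
    `|f p| <= M * (2 * S / e) * \1_(`[a, b + e]%classic `*` `[0, T]%classic) p.
  move: p => [z t]; rewrite /f /= !indicE in_setX /=.
  have [zt|zt] := boolP (t \in `[0, T]%classic); last by rewrite mulr0 andbF mulr0 normr0.
  have [za|za] := boolP (a <= z <= b + e).
    rewrite mem_set//= !mulr1 normrN normrM ler_pM//.
  by rewrite X'0// mulr0 oppr0 mul0r normr0 mulr_ge0 ?ler0n// mulr_ge0// divr_ge0 ?(ltW e0)// mulr_ge0.
have fi : (leb \x leb)%E.-integrable [set: R * R] (EFin \o f).
  exact: (leb2_dominated mf f1 (integrable_box _ _ _ _ _)).
have A1 t := @bump_avg R s S e a L (fun z => B z t) e0 L0 sS (mBz t).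
have A2 t := @bump_avg R s S e b L (fun z => B z t) e0 L0 sS (mBz t).
have LBz c t z : `|B z t - B c t| <= L * `|z - c|.
  by have := LB z c t t; rewrite subrr normr0 addr0.
have fE t : (fun z => f (z, t)) = (fun z => - \1_(`[0, T]%classic : set R) t *
   (B z t * (e^-1 * derive1 s (e^-1 * (z - a))) - B z t * (e^-1 * derive1 s (e^-1 * (z - b))))).
  by apply/funext => z; rewrite /f /= X'E; ring.
have fi1 t : leb.-integrable [set: R] (EFin \o (fun z => f (z, t))).
  rewrite fE; apply: integrable_scale => //; apply: integrable_sub => //.
    by have [] := A1 t (LBz a t).
  by have [] := A2 t (LBz b t).
have [mG fG] := Rintegral_prod2 fi fi1.
have Gd t : `|\int[leb]_z f (z, t) - D t| <= 2 * L * S * e * \1_(`[0, T]%classic : set R) t.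
  have [i1 h1] := A1 t (LBz a t); have [i2 h2] := A2 t (LBz b t).
  rewrite fE RintegralZl//; last exact: integrable_sub.
  rewrite RintegralB// /D indicE.
  case: (t \in _); last by rewrite oppr0 mul0r !mulr0 subrr normr0.
  by rewrite !mulr1 mulN1r -!mulrA [L * _]mulrA (norm_sub_sub_le h1 h2).
have mGD : measurable_fun [set: R] (fun t => \int[leb]_z f (z, t) - D t).
  exact: measurable_funB.
have iGD := leb_dominated mGD Gd (integrable_scale _ measurableT iT).
have Gi : leb.-integrable [set: R] (EFin \o (fun t => \int[leb]_z f (z, t))).
  have := integrable_add measurableT iGD iD; apply: eq_integrable => // t _.
  by rewrite /= subrK.
have E1 : `|\int[leb]_z (g z * X z) - \int[leb]_t D t| <= 2 * L * S * T * e.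
  rewrite -fgX fG -RintegralB//.
  apply: (le_trans (leb_norm_le mGD Gd (integrable_scale _ measurableT iT))).
  rewrite RintegralZl// (_ : \int[leb]_x _ = T); first lra.
  have H := @Rintegral_indicM R 0 T 1 (ltW T0); rewrite subr0 mul1r in H; rewrite -[RHS]H.
  by apply: eq_Rintegral => x _; rewrite mul1r.
have E2 : `|\int[leb]_z (g z * X z) - \int[leb]_z (g z * \1_(`[a, b]%classic : set R) z)| <= 4 * M * e.
  have mgi : measurable_fun [set: R] (fun z => g z * \1_(`[a, b]%classic : set R) z).
    by apply: measurable_funM => //; exact: measurable_indic.
  have gi1 z : `|g z * \1_(`[a, b]%classic : set R) z| <= 2 * M * \1_(`[a, b]%classic : set R) z.
    by rewrite normrM ler_pM// ger0_norm// indicE ler0n.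
  have igi := leb_dominated mgi gi1 (integrable_indicM _ (ltW ab)).
  have md : measurable_fun [set: R] (fun z => g z * (X z - \1_(`[a, b]%classic : set R) z)).
    by apply: measurable_funM => //; apply: measurable_funB => //; exact: measurable_indic.
  have d1 z : `|g z * (X z - \1_(`[a, b]%classic : set R) z)| <=
      2 * M * \1_(`[a, a + e]%classic : set R) z + 2 * M * \1_(`[b, b + e]%classic : set R) z.
    by rewrite normrM -mulrDr ler_pM//; exact: (plateau_indic _ e0 ab sS).
  have ae : a <= a + e by rewrite lerDl ltW.
  have be : b <= b + e by rewrite lerDl ltW.
  have idd := integrable_add measurableT (integrable_indicM (2 * M) ae) (integrable_indicM (2 * M) be).
  have id := leb_dominated md d1 idd.
  have -> : \int[leb]_z (g z * X z) = \int[leb]_z (g z * (X z - \1_(`[a, b]%classic : set R) z)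
     + g z * \1_(`[a, b]%classic : set R) z).
    by apply: eq_Rintegral => z _; ring.
  rewrite RintegralD// addrK.
  apply: (le_trans (leb_norm_le md d1 idd)).
  rewrite RintegralD//; try exact: integrable_indicM.
  by rewrite !Rintegral_indicM//; lra.
rewrite distrC in E2.
have := ler_distD (\int[leb]_z (g z * X z)) (\int[leb]_z (g z * \1_(`[a, b]%classic : set R) z)) (\int[leb]_t D t).
lra.
Qed.

(** * The balance law on slabs and its Euler discretisation *)

(** Serves two purposes: evaluating slab integrals of nearly constant functions, and, through its
    first conclusion, supplying integrability on bounded intervals. *)
Lemma Rintegral_near (R : realType) (A : set R) (l c k : R) (h : R -> R) : measurable A ->
  leb A = l%:E -> measurable_fun [set: R] h -> 0 <= k ->
  (forall x, A x -> `|h x - c| <= k) ->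
  leb.-integrable A (EFin \o h) /\ `|\int[leb]_(x in A) h x - l * c| <= l * k.
Proof.
move=> mA lA mh k0 hc.
have ik (d : R) : leb.-integrable A (EFin \o (fun _ => d)).
  apply: measurable_bounded_integrable => //; first by rewrite [X in (X < _)%E]lA ltry.
  exact: bounded_cst.
have mhA : measurable_fun A h by exact: measurable_funTS.
have mA' : measurable_fun A (fun x => h x - c) by exact: measurable_funB.
have cst_int (d : R) : \int[leb]_(x in A) d = l * d.
  by rewrite Rintegral_cst// [X in fine X]lA mulrC.
have ih : leb.-integrable A (EFin \o h).
  apply: (@dominated_integrable _ _ R leb A h (fun _ => `|c| + k) mA mhA _ (ik _)).
  move=> x /hc H; rewrite -(subrK c (h x)) addrC.
  by apply: (le_trans (ler_normD _ _)); rewrite lerD.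
split => //.
rewrite -cst_int -RintegralB//.
rewrite -(cst_int k).
exact: (@norm_Rintegral_le _ _ R leb A (fun x => h x - c) (fun _ => k) mA mA' hc (ik k)).
Qed.

(** The time interval is half-open because the identity arises by subtracting an integral over
    [[0, t1]] from one over [[0, t2]]. *)
Definition slab_balance {R : realType} (w B : R -> R -> R) := forall t1 t2 a b : R,
  0 <= t1 -> t1 < t2 -> a < b ->
  \int[leb]_(z in `[a, b]) (w z t2 - w z t1) = \int[leb]_(t in `]t1, t2]) (B b t - B a t).

Lemma leb_itvcc (R : realType) (a b : R) : a <= b -> leb `[a, b]%classic = (b - a)%:E.
Proof.
move=> ab; rewrite lebesgue_measure_itv/= lte_fin.
have [//|ba] := ltP a b.
by rewrite (_ : b = a) ?subrr//; apply: le_anti; rewrite ab ba.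
Qed.

Lemma leb_itvoc (R : realType) (a b : R) : a <= b -> leb `]a, b]%classic = (b - a)%:E.
Proof.
move=> ab; rewrite lebesgue_measure_itv/= lte_fin.
have [//|ba] := ltP a b.
by rewrite (_ : b = a) ?subrr//; apply: le_anti; rewrite ab ba.
Qed.

(** The weak formulation prescribes the initial datum only through an integral. Pointwise attainment
    is recovered from thin slabs above [[a, a + d]] whose height is so small that the flux through
    the sides is negligible against [d]. *)
Lemma slab_initial (R : realType) (w B : R -> R -> R) (w0 : R -> R) (L M : R) :
  0 <= L -> 0 <= M -> lip2 L w -> lip2 L B -> (forall z t, `|B z t| <= M) ->
  (forall z z', `|w0 z - w0 z'| <= L * `|z - z'|) -> measurable_fun [set: R] w0 ->
  (forall T a b, 0 < T -> a < b ->
    \int[leb]_(z in `[a, b]) (w z T - w0 z) = \int[leb]_(t in `[0, T]) (B b t - B a t)) ->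
  forall z, w z 0 = w0 z.
Proof.
move=> L0 M0 Lw LB BM Lw0 mw0 slab a.
apply: (@small_multiple_eq _ (2 * M + 3 * L)) => d d0.
(* This height satisfies both [T <= d], which keeps the Lipschitz error of order [d], and
   [T <= d * d], which makes the flux term quadratic. *)
pose T := d ^+ 2 / (1 + d).
have T0 : 0 < T by rewrite divr_gt0// ?exprn_gt0//; lra.
have Td : T <= d by rewrite ler_pdivrMr; nra.
have Td2 : T <= d * d by rewrite ler_pdivrMr; nra.
have ad : a <= a + d by lra.
have [||z|_ H1] := @Rintegral_near R `[a, a + d]%classic (a + d - a) (w a 0 - w0 a) (3 * L * d)
  (fun z => w z T - w0 z) (measurable_itv _) (leb_itvcc ad).
- exact: measurable_funB (lip2_measurable1 T L0 Lw) mw0.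
- by rewrite !mulr_ge0// ltW.
- rewrite /= in_itv/= => /andP[az zd].
  have za : `|z - a| <= d by rewrite ler_norml; lra.
  have E1 := Lw z a T 0; have E2 := Lw0 a z.
  rewrite subr0 (gtr0_norm T0) in E1; rewrite distrC in za; rewrite (distrC z a) in E1.
  have E3 : L * (`|a - z| + T) <= L * (2 * d) by rewrite ler_wpM2l//; lra.
  have E4 : L * `|a - z| <= L * d by rewrite ler_wpM2l.
  have -> : w z T - w0 z - (w a 0 - w0 a) = (w z T - w a 0) + (w0 a - w0 z) by ring.
  by apply: (le_trans (ler_normD _ _)); lra.
have [||t|_ H2] := @Rintegral_near R `[0, T]%classic (T - 0) 0 (2 * M)
  (fun t => B (a + d) t - B a t) (measurable_itv _) (leb_itvcc (ltW T0)).
- by apply: measurable_funB; exact: lip2_measurable2 L0 LB.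
- by rewrite mulr_ge0.
- move=> _; rewrite subr0 (le_trans (ler_normB _ _))//.
  by have := BM (a + d) t; have := BM a t; lra.
rewrite slab// in H1; last lra.
rewrite mulr0 !subr0 in H2; rewrite [a + d]addrC addrK [d + a]addrC in H1.
have H3 := ler_normB (\int[leb]_(t in `[0, T]) (B (a + d) t - B a t))
  (\int[leb]_(t in `[0, T]) (B (a + d) t - B a t) - d * (w a 0 - w0 a)).
rewrite subKr normrM (gtr0_norm d0) in H3.
have H4 : d * `|w a 0 - w0 a| <= d * ((2 * M + 3 * L) * d).
  apply: (le_trans H3).
  apply: (le_trans (lerD H2 H1)).
  have : T * (2 * M) <= d * d * (2 * M) by rewrite ler_wpM2r// mulr_ge0.
  lra.
by rewrite -(ler_pM2l d0).
Qed.

(** Obtained by subtracting the identities up to [t2] and up to [t1]. For [t1 = 0] the second one is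
    not among the hypotheses; there both sides vanish, by [slab_initial]. *)
Lemma slab_balance_of (R : realType) (w B : R -> R -> R) (w0 : R -> R) (L M : R) :
  0 <= L -> 0 <= M -> lip2 L w -> lip2 L B -> (forall z t, `|B z t| <= M) ->
  (forall z z', `|w0 z - w0 z'| <= L * `|z - z'|) -> measurable_fun [set: R] w0 ->
  (forall T a b, 0 < T -> a < b ->
    \int[leb]_(z in `[a, b]) (w z T - w0 z) = \int[leb]_(t in `[0, T]) (B b t - B a t)) ->
  slab_balance w B.
Proof.
move=> L0 M0 Lw LB BM Lw0 mw0 slab t1 t2 a b t10 t12 ab.
have init := slab_initial L0 M0 Lw LB BM Lw0 mw0 slab.
have iw t : leb.-integrable `[a, b]%classic (EFin \o (fun z => w z t - w0 z)).
  have Lww z z' : `|w z t - w0 z - (w z' t - w0 z')| <= 2 * L * `|z - z'|.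
    have := Lw z z' t t; have := Lw0 z' z; rewrite subrr normr0 addr0 (distrC z') => E1 E2.
    have -> : w z t - w0 z - (w z' t - w0 z') = (w z t - w z' t) + (w0 z' - w0 z) by ring.
    by apply: (le_trans (ler_normD _ _)); lra.
  have [||z|//] := @Rintegral_near R `[a, b]%classic (b - a) (w a t - w0 a) (2 * L * (b - a))
    (fun z => w z t - w0 z) (measurable_itv _) (leb_itvcc (ltW ab)).
  - exact: measurable_funB (lip2_measurable1 t L0 Lw) mw0.
  - by rewrite !mulr_ge0//; lra.
  - rewrite /= in_itv/= => /andP[az zb]; apply: (le_trans (Lww _ _)).
    by rewrite ler_wpM2l ?mulr_ge0// ger0_norm; lra.
have iB T : 0 <= T -> leb.-integrable `[0, T]%classic (EFin \o (fun t => B b t - B a t)).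
  move=> T0; have [||t|//] := @Rintegral_near R `[0, T]%classic (T - 0) 0 (2 * M)
    (fun t => B b t - B a t) (measurable_itv _) (leb_itvcc T0).
  - by apply: measurable_funB; exact: lip2_measurable2 L0 LB.
  - by rewrite mulr_ge0.
  - move=> _; rewrite subr0 (le_trans (ler_normB _ _))//.
    by have := BM b t; have := BM a t; lra.
have slab0 T : 0 <= T ->
    \int[leb]_(z in `[a, b]) (w z T - w0 z) = \int[leb]_(t in `[0, T]) (B b t - B a t).
  rewrite le_eqVlt => /predU1P[<-|T0]; last exact: slab.
  rewrite set_itv1 Rintegral_set1.
  under eq_Rintegral do rewrite init subrr.
  by rewrite Rintegral_cst// mul0r.
transitivity (\int[leb]_(z in `[a, b]) ((w z t2 - w0 z) - (w z t1 - w0 z))).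
  by apply: eq_Rintegral => z _; ring.
have t20 : 0 <= t2 by lra.
rewrite RintegralB// slab0// slab0//.
by rewrite (Rintegral_itvB (iB t2 t20))// bnd_simp ?(ltW t12).
Qed.

Lemma slab_balanceB (R : realType) (w v Bw Bv : R -> R -> R) (L : R) : 0 <= L ->
  lip2 L w -> lip2 L v -> lip2 L Bw -> lip2 L Bv ->
  slab_balance w Bw -> slab_balance v Bv ->
  slab_balance (fun z t => w z t - v z t) (fun z t => Bw z t - Bv z t).
Proof.
move=> L0 Lw Lv LBw LBv Sw Sv t1 t2 a b t10 t12 ab.
have i1 f : lip2 L f ->
    leb.-integrable `[a, b]%classic (EFin \o (fun z => f z t2 - f z t1)).
  move=> Lf; have [||z|//] := @Rintegral_near R `[a, b]%classic (b - a) 0 (L * (t2 - t1))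
    (fun z => f z t2 - f z t1) (measurable_itv _) (leb_itvcc (ltW ab)).
  - by apply: measurable_funB; exact: lip2_measurable1 L0 Lf.
  - by rewrite mulr_ge0//; lra.
  - move=> _; rewrite subr0; have := Lf z z t2 t1.
    by rewrite subrr normr0 add0r (ger0_norm (_ : 0 <= t2 - t1))//; lra.
have i2 f : lip2 L f ->
    leb.-integrable `]t1, t2]%classic (EFin \o (fun t => f b t - f a t)).
  move=> Lf; have [||z|//] := @Rintegral_near R `]t1, t2]%classic (t2 - t1) 0 (L * (b - a))
    (fun t => f b t - f a t) (measurable_itv _) (leb_itvoc (ltW t12)).
  - by apply: measurable_funB; exact: lip2_measurable2 L0 Lf.
  - by rewrite mulr_ge0//; lra.
  - move=> _; rewrite subr0; have := Lf b a z z.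
    by rewrite subrr normr0 addr0 (ger0_norm (_ : 0 <= b - a))//; lra.
transitivity (\int[leb]_(z in `[a, b]) ((w z t2 - w z t1) - (v z t2 - v z t1))).
  by apply: eq_Rintegral => z _; ring.
rewrite RintegralB//; try exact: i1.
rewrite Sw// Sv// -RintegralB//; try exact: i2.
by apply: eq_Rintegral => z _; ring.
Qed.

(** The same slab integral is compared with [d] times the increment of [u] and with [t2 - t1] times
    the increment of [B], and the result is divided by [d]. The factor [d] in the time regularity of
    [B] is what survives this division. *)
Lemma euler_increment (R : realType) (u B : R -> R -> R) (L K t1 t2 a d : R) :
  0 <= L -> 0 <= K -> lip2 L u -> (forall z, measurable_fun [set: R] (fun t => B z t)) ->
  slab_balance u B -> 0 <= t1 -> t1 < t2 -> 0 < d ->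
  (forall t, `|(B (a + d) t - B a t) - (B (a + d) t1 - B a t1)| <= d * K * `|t - t1|) ->
  `|u a t2 - u a t1 - (t2 - t1) * ((B (a + d) t1 - B a t1) / d)|
    <= K * (t2 - t1) ^+ 2 + 2 * L * d.
Proof.
move=> L0 K0 Lu mB bal t10 t12 d0 BK.
have ad : a <= a + d by lra.
have [||z|_ H1] := @Rintegral_near R `[a, a + d]%classic (a + d - a) (u a t2 - u a t1) (2 * L * d)
  (fun z => u z t2 - u z t1) (measurable_itv _) (leb_itvcc ad).
- by apply: measurable_funB; exact: lip2_measurable1 L0 Lu.
- by rewrite !mulr_ge0// ltW.
- rewrite /= in_itv/= => /andP[az zd].
  have E1 := Lu z a t2 t2; have E2 := Lu a z t1 t1.
  rewrite !subrr normr0 !addr0 in E1 E2; rewrite (distrC a) in E2.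
  have za : `|z - a| <= d by rewrite ler_norml; lra.
  have E3 : L * `|z - a| <= L * d by rewrite ler_wpM2l.
  have -> : u z t2 - u z t1 - (u a t2 - u a t1) = (u z t2 - u a t2) + (u a t1 - u z t1) by ring.
  by apply: (le_trans (ler_normD _ _)); lra.
have [||t|_ H2] := @Rintegral_near R `]t1, t2]%classic (t2 - t1) (B (a + d) t1 - B a t1)
  (d * K * (t2 - t1)) (fun t => B (a + d) t - B a t) (measurable_itv _) (leb_itvoc (ltW t12)).
- exact: measurable_funB.
- by rewrite !mulr_ge0//; lra.
- rewrite /= in_itv/= => /andP[tt1 tt2]; apply: (le_trans (BK t)).
  by rewrite ler_wpM2l ?mulr_ge0 ?(ltW d0)// gtr0_norm; lra.
have adE : a + d - a = d by ring.
rewrite bal// ?adE in H1; last lra.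
set I := Rintegral _ _ _ in H1 H2.
rewrite -(ler_pM2l d0).
have -> : d * `|u a t2 - u a t1 - (t2 - t1) * ((B (a + d) t1 - B a t1) / d)| =
  `|(I - (t2 - t1) * (B (a + d) t1 - B a t1)) - (I - d * (u a t2 - u a t1))|.
  rewrite -{1}(gtr0_norm d0) -normrM; congr `|_|; field; lra.
apply: (le_trans (ler_normB _ _)); apply: (le_trans (lerD H2 H1)); rewrite expr2; lra.
Qed.

(** * Averaging against a monotone kernel *)

Record is_kernel {R : realType} (P : R -> R) : Prop := IsKernel {
  kernel_meas : measurable_fun [set: R] P;
  kernel_ge0 : forall z, 0 <= P z;
  kernel_neg : forall z, z < 0 -> P z = 0;
  kernel_mono : forall x y, 0 <= x -> x <= y -> P y <= P x;
  kernel_int : leb.-integrable [set: R] (EFin \o P);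
  kernel_mass : \int[leb]_z P z = 1;
  kernel_moment : leb.-integrable [set: R] (EFin \o (fun z => z * P z)) }.

Definition avg {R : realType} (P h : R -> R) (z : R) := \int[leb]_s (P s * h (z + s)).

(* [khead] and [kdiff] split the increment of the kernel into nonnegative parts,
   see [kernel_shiftE]. *)
Definition khead {R : realType} (P : R -> R) (d s : R) := if 0 <= s < d then P s else 0.

Definition kdiff {R : realType} (P : R -> R) (d s : R) :=
  if d <= s then (P (s - d) - P s) / d else 0.

Lemma measurable_if_le (R : realType) (f : R -> R) (p : pred R) :
  measurable [set x | p x] ->
  measurable_fun [set: R] f -> measurable_fun [set: R] (fun x => if p x then f x else 0).
Proof.
move=> mp mf; rewrite (_ : (fun _ => _) = f \* (\1_[set x | p x] : R -> R)).
  by apply: measurable_funM => //; exact: measurable_indic.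
apply/funext => x /=; rewrite indicE; case: ifPn => px; first by rewrite mem_set ?mulr1.
by rewrite memNset ?mulr0//=; exact/negP.
Qed.

Lemma kernel_le0 (R : realType) (P : R -> R) z : is_kernel P -> P z <= P 0.
Proof.
move=> kP; have [z0|z0] := leP 0 z; first exact: (kernel_mono kP).
by rewrite (kernel_neg kP) ?(kernel_ge0 kP).
Qed.

Lemma measurable_khead (R : realType) (P : R -> R) d : is_kernel P ->
  measurable_fun [set: R] (khead P d).
Proof.
move=> kP; apply: (@measurable_if_le _ P (fun s => 0 <= s < d)); last exact: kernel_meas.
by rewrite (_ : [set x | _] = `[0, d[%classic).
Qed.

Lemma measurable_kdiff (R : realType) (P : R -> R) d : is_kernel P ->
  measurable_fun [set: R] (kdiff P d).
Proof.
move=> kP; apply: (@measurable_if_le _ (fun s => (P (s - d) - P s) / d) (fun s => d <= s)).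
  rewrite (_ : [set x | _] = `[d, +oo[%classic)//.
  by apply/seteqP; split => x /=; rewrite in_itv/= andbT.
apply: measurable_funM => //; apply: measurable_funB; last exact: kernel_meas.
apply: (measurableT_comp (kernel_meas kP)); exact: measurable_funB.
Qed.

Lemma khead_ge0 (R : realType) (P : R -> R) d s : is_kernel P -> 0 <= khead P d s.
Proof. by move=> kP; rewrite /khead; case: ifP => // _; exact: kernel_ge0. Qed.

Lemma kdiff_ge0 (R : realType) (P : R -> R) d s : is_kernel P -> 0 < d -> 0 <= kdiff P d s.
Proof.
move=> kP d0; rewrite /kdiff; case: ifP => // ds.
by rewrite divr_ge0 ?(ltW d0)// subr_ge0 (kernel_mono kP); lra.
Qed.

Lemma kdiff_neg (R : realType) (P : R -> R) d s : 0 < d -> s < 0 -> kdiff P d s = 0.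
Proof. by move=> d0 s0; rewrite /kdiff ifF//; apply/negbTE; rewrite -ltNge; lra. Qed.

(** For [s >= d] monotonicity makes the difference nonnegative, and [kdiff] plays the part of -P'.
    On [0, d) the shifted kernel vanishes, and [khead] records the jump of the extended kernel at
    the origin. *)
Lemma kernel_shiftE (R : realType) (P : R -> R) d s : is_kernel P -> 0 < d ->
  P (s - d) - P s = d * kdiff P d s - khead P d s.
Proof.
move=> kP d0; rewrite /kdiff /khead.
have [ds|ds] := leP d s; rewrite ?andbF ?andbT.
  by rewrite subr0; field; lra.
rewrite (kernel_neg kP (_ : s - d < 0)); last lra.
by rewrite mulr0; case: ifPn => // s0; rewrite (kernel_neg kP (_ : s < 0))// ltNge.
Qed.

Lemma khead_le (R : realType) (P : R -> R) d s : is_kernel P -> `|khead P d s| <= P s.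
Proof.
move=> kP; rewrite (ger0_norm (khead_ge0 _ _ kP)) /khead.
by case: ifP => _ //; exact: kernel_ge0.
Qed.

Lemma integrable_khead (R : realType) (P : R -> R) d : is_kernel P ->
  leb.-integrable [set: R] (EFin \o khead P d).
Proof.
move=> kP; apply: (leb_dominated (measurable_khead d kP) _ (kernel_int kP)) => s.
exact: khead_le.
Qed.

Lemma integrable_kernel_shift (R : realType) (P : R -> R) d : is_kernel P ->
  leb.-integrable [set: R] (EFin \o (fun s => P (s - d))).
Proof. by move=> kP; have := integrable_shift (- d) (kernel_int kP). Qed.

Lemma integrable_kdiff (R : realType) (P : R -> R) d : is_kernel P -> 0 < d ->
  leb.-integrable [set: R] (EFin \o kdiff P d).
Proof.
move=> kP d0.
have H := integrable_scale d^-1 measurableT (integrable_add measurableT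
  (integrable_sub measurableT (integrable_kernel_shift d kP) (kernel_int kP)) (integrable_khead d kP)).
apply: eq_integrable H => // s _ /=; rewrite kernel_shiftE//; congr EFin; field; lra.
Qed.

Lemma integrable_bddM (R : realType) (k h : R -> R) (M : R) :
  leb.-integrable [set: R] (EFin \o k) -> measurable_fun [set: R] h ->
  (forall x, `|h x| <= M) -> leb.-integrable [set: R] (EFin \o (fun x => k x * h x)).
Proof.
move=> ik mh hM.
have mk : measurable_fun [set: R] k by apply/measurable_EFinP; exact: (measurable_int _ ik).
have ink : leb.-integrable [set: R] (EFin \o (fun x => M * `|k x|)).
  by apply: integrable_scale => //; exact: (integrable_norm ik).
apply: (leb_dominated _ _ ink); first exact: measurable_funM.
by move=> x; rewrite normrM mulrC ler_wpM2r.
Qed.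

Lemma measurable_shift (R : realType) (h : R -> R) (a : R) :
  measurable_fun [set: R] h -> measurable_fun [set: R] (fun s => h (a + s)).
Proof. by move=> mh; apply: (measurableT_comp mh); exact: measurable_funD. Qed.

(** A change of variables moves the translation from [h] to the kernel, so no regularity of [h]
    beyond boundedness and measurability enters. *)
Lemma avg_increment (R : realType) (P h : R -> R) (M a d : R) : is_kernel P -> 0 < d ->
  measurable_fun [set: R] h -> (forall x, `|h x| <= M) ->
  avg P h (a + d) - avg P h a =
  d * (\int[leb]_s (kdiff P d s * h (a + s))) - \int[leb]_s (khead P d s * h (a + s)).
Proof.
move=> kP d0 mh hM.
have mha := measurable_shift a mh.
have i0 := integrable_bddM (kernel_int kP) mha (fun s => hM (a + s)).
have i1 := integrable_bddM (integrable_kernel_shift d kP) mha (fun s => hM (a + s)).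
have i2 := integrable_bddM (integrable_kdiff kP d0) mha (fun s => hM (a + s)).
have i3 := integrable_bddM (integrable_khead d kP) mha (fun s => hM (a + s)).
have mhd := measurable_shift (a + d) mh.
have i4 := integrable_bddM (kernel_int kP) mhd (fun s => hM (a + d + s)).
have -> : avg P h (a + d) = \int[leb]_s (P (s - d) * h (a + s)).
  rewrite /avg -(Rintegral_shift (- d) i4); apply: eq_Rintegral => s _.
  by congr (_ * h _); ring.
rewrite /avg -RintegralB// -RintegralZl// -RintegralB//; last exact: integrable_scale.
by apply: eq_Rintegral => s _; rewrite -mulrBl kernel_shiftE//; ring.
Qed.

(** This is [avg_increment] for the constant function 1, whose average does not vary. *)
Lemma mass_kdiff (R : realType) (P : R -> R) d : is_kernel P -> 0 < d ->
  d * \int[leb]_s kdiff P d s = \int[leb]_s khead P d s.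
Proof.
move=> kP d0; have := @avg_increment R P (fun _ => 1) 1 0 d kP d0.
rewrite /avg.
under [in X in _ = X]eq_Rintegral do rewrite mulr1.
under [X in _ = _ - X]eq_Rintegral do rewrite mulr1.
rewrite subrr => /(_ _ _)/eqP H; apply/eqP; rewrite eq_sym -subr_eq0 -oppr_eq0 opprB eq_sym H//.
by move=> _; rewrite normr1.
Qed.

Lemma khead_indic_le (R : realType) (P : R -> R) d s : is_kernel P -> 0 < d ->
  `|khead P d s| <= P 0 * \1_(`[0, d]%classic : set R) s.
Proof.
move=> kP d0; rewrite (ger0_norm (khead_ge0 _ _ kP)) /khead indicE.
case: ifPn => H; last by rewrite mulr_ge0 ?ler0n ?(kernel_ge0 kP).
rewrite mem_set ?mulr1 ?kernel_le0//=.
by rewrite in_itv/=; case/andP: H => -> /ltW ->.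
Qed.

Lemma mass_khead_le (R : realType) (P : R -> R) d : is_kernel P -> 0 < d ->
  \int[leb]_s khead P d s <= d * P 0.
Proof.
move=> kP d0; apply: (le_trans (ler_norm _)).
apply: (le_trans (leb_norm_le (measurable_khead d kP) (fun s => khead_indic_le s kP d0)
  (integrable_indicM _ (ltW d0)))).
by rewrite Rintegral_indicM ?(ltW d0)// subr0 mulrC.
Qed.

(** A summation by parts: translating a kernel of mass 1 by [d] raises its first moment by [d], and
    the head contributes at most [d * (d * P 0)]. Division by [d] gives the bound. *)
Lemma moment_kdiff (R : realType) (P : R -> R) d : is_kernel P -> 0 < d ->
  leb.-integrable [set: R] (EFin \o (fun s => s * kdiff P d s)) /\
  \int[leb]_s (s * kdiff P d s) <= 1 + d * P 0.
Proof.
move=> kP d0.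
have i1 : leb.-integrable [set: R] (EFin \o (fun s => s * P (s - d))).
  have H := integrable_add measurableT (integrable_shift (- d) (kernel_moment kP))
    (integrable_scale d measurableT (integrable_kernel_shift d kP)).
  by apply: eq_integrable H => // s _ /=; congr EFin; ring.
have I1 : \int[leb]_s (s * P (s - d)) = \int[leb]_s (s * P s) + d.
  rewrite -(Rintegral_shift (- d) (kernel_moment kP)).
  have Id : \int[leb]_s (d * P (s - d)) = d.
    rewrite RintegralZl//; last exact: integrable_kernel_shift.
    by rewrite (Rintegral_shift (- d) (kernel_int kP)) (kernel_mass kP) mulr1.
  rewrite -[X in _ + X]Id -RintegralD//.
  - by apply: eq_Rintegral => s _; ring.
  - exact: (integrable_shift (- d) (kernel_moment kP)).
  - by apply: integrable_scale => //; exact: integrable_kernel_shift.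
have mh : measurable_fun [set: R] (fun s => s * khead P d s).
  by apply: measurable_funM => //; exact: measurable_khead.
have hd s : `|s * khead P d s| <= d * P 0 * \1_(`[0, d]%classic : set R) s.
  rewrite normrM /khead; case: ifPn => H; last first.
    by rewrite normr0 mulr0 !mulr_ge0 ?ler0n ?(kernel_ge0 kP) ?(ltW d0).
  case/andP: H => s0 sd.
  rewrite indicE mem_set ?mulr1; last by rewrite /= in_itv/= s0 ltW.
  by rewrite ler_pM// ger0_norm ?(ltW sd) ?(kernel_ge0 kP) ?kernel_le0.
have i2 := leb_dominated mh hd (integrable_indicM _ (ltW d0)).
have I2 := leb_norm_le mh hd (integrable_indicM _ (ltW d0)).
rewrite Rintegral_indicM ?(ltW d0)// subr0 in I2.
have E s : s * kdiff P d s = d^-1 * (s * P (s - d) - s * P s + s * khead P d s).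
  by rewrite -mulrBr kernel_shiftE//; field; lra.
have i3 := integrable_sub measurableT i1 (kernel_moment kP).
have i4 := integrable_add measurableT i3 i2.
split.
  by apply: eq_integrable (integrable_scale d^-1 measurableT i4) => // s _; rewrite /= E.
under eq_Rintegral do rewrite E.
rewrite RintegralZl// RintegralD// RintegralB ?I1//; last exact: (kernel_moment kP).
rewrite mulrC ler_pdivrMr//.
have := ler_norm (\int[leb]_s (s * khead P d s)).
lra.
Qed.

Lemma avgB (R : realType) (P h1 h2 : R -> R) (M z z' : R) : is_kernel P ->
  measurable_fun [set: R] h1 -> measurable_fun [set: R] h2 ->
  (forall x, `|h1 x| <= M) -> (forall x, `|h2 x| <= M) ->
  avg P h1 z - avg P h2 z' = \int[leb]_s (P s * (h1 (z + s) - h2 (z' + s))).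
Proof.
move=> kP m1 m2 b1 b2.
have i1 := integrable_bddM (kernel_int kP) (measurable_shift z m1) (fun s => b1 (z + s)).
have i2 := integrable_bddM (kernel_int kP) (measurable_shift z' m2) (fun s => b2 (z' + s)).
by rewrite /avg -RintegralB//; apply: eq_Rintegral => s _; rewrite mulrBr.
Qed.

Lemma norm_avgB_le (R : realType) (P h1 h2 : R -> R) (M C z z' : R) : is_kernel P ->
  measurable_fun [set: R] h1 -> measurable_fun [set: R] h2 ->
  (forall x, `|h1 x| <= M) -> (forall x, `|h2 x| <= M) ->
  (forall s, `|h1 (z + s) - h2 (z' + s)| <= C) ->
  `|avg P h1 z - avg P h2 z'| <= C.
Proof.
move=> kP m1 m2 b1 b2 hC; rewrite (avgB _ _ kP m1 m2 b1 b2).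
have md : measurable_fun [set: R] (fun s => P s * (h1 (z + s) - h2 (z' + s))).
  apply: measurable_funM; first exact: kernel_meas.
  by apply: measurable_funB; exact: measurable_shift.
have d1 s : `|P s * (h1 (z + s) - h2 (z' + s))| <= C * P s.
  by rewrite normrM (ger0_norm (kernel_ge0 kP s)) mulrC ler_wpM2r// kernel_ge0.
apply: (le_trans (leb_norm_le md d1 (integrable_scale C measurableT (kernel_int kP)))).
rewrite RintegralZl//; first by rewrite (kernel_mass kP) mulr1.
exact: kernel_int.
Qed.

Lemma avg_lip2 (R : realType) (P : R -> R) (f : R -> R -> R) (L M : R) : is_kernel P ->
  0 <= L -> lip2 L f -> (forall z t, `|f z t| <= M) ->
  lip2 L (fun z t => avg P (fun x => f x t) z).
Proof.
move=> kP L0 Lf fM z z' t t'.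
apply: (norm_avgB_le kP (lip2_measurable1 t L0 Lf) (lip2_measurable1 t' L0 Lf)
  (fun x => fM x t) (fun x => fM x t')) => s.
by have := Lf (z + s) (z' + s) t t'; rewrite (_ : z + s - (z' + s) = z - z')//; ring.
Qed.

Lemma norm_avg_le (R : realType) (P h : R -> R) (M z : R) : is_kernel P ->
  measurable_fun [set: R] h -> (forall x, `|h x| <= M) -> `|avg P h z| <= M.
Proof.
move=> kP mh hM; have M0 : 0 <= M := le_trans (normr_ge0 _) (hM 0).
have := @norm_avgB_le R P h (fun _ => 0) M M z 0 kP mh (measurable_cst _) hM.
rewrite [avg P (fun _ => 0) 0](_ : _ = 0) ?subr0; last first.
  rewrite /avg; under eq_Rintegral do rewrite mulr0.
  by rewrite Rintegral_cst// mul0r.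
apply; first by move=> _; rewrite normr0.
by move=> s; rewrite subr0.
Qed.

(** The bound on [h] is required only where [k] does not vanish. For [k = khead P d] this restricts
    attention to [0, d), where a Lipschitz function is nearly constant. *)
Lemma norm_kintegral_le (R : realType) (k h : R -> R) (M : R) :
  leb.-integrable [set: R] (EFin \o k) -> (forall s, 0 <= k s) ->
  measurable_fun [set: R] h -> (forall s, k s != 0 -> `|h s| <= M) ->
  `|\int[leb]_s (k s * h s)| <= M * \int[leb]_s k s.
Proof.
move=> ik k0 mh hM; rewrite -RintegralZl//.
apply: leb_norm_le; last exact: integrable_scale.
  apply: measurable_funM => //.
  by apply/measurable_EFinP; exact: (measurable_int _ ik).
move=> s; rewrite normrM (ger0_norm (k0 s)) mulrC.
have [->|ks] := eqVneq (k s) 0; first by rewrite !mulr0.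
by rewrite ler_wpM2r// hM.
Qed.

(** Both parts of the kernel increment have mass at most [d * P 0]. Averaging thus makes bounded
    functions Lipschitz; this applies to time increments of the flux as well as to initial data of
    bounded variation, which may jump. *)
Lemma avg_increment_le (R : realType) (P h : R -> R) (M a d : R) : is_kernel P -> 0 < d ->
  measurable_fun [set: R] h -> (forall x, `|h x| <= M) ->
  `|avg P h (a + d) - avg P h a| <= d * (2 * P 0 * M).
Proof.
move=> kP d0 mh hM; rewrite (avg_increment a kP d0 mh hM).
have mha := measurable_shift a mh.
have M0 : 0 <= M := le_trans (normr_ge0 _) (hM 0).
have H1 := norm_kintegral_le (integrable_kdiff kP d0) (fun s => kdiff_ge0 s kP d0) mha
  (fun s _ => hM (a + s)).
have H2 := norm_kintegral_le (integrable_khead d kP) (fun s => khead_ge0 d s kP) mha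
  (fun s _ => hM (a + s)).
have H3 := mass_khead_le kP d0.
apply: (le_trans (ler_normB _ _)); rewrite normrM (gtr0_norm d0).
have H4 : d * `|\int[leb]_s (kdiff P d s * h (a + s))| <= M * (d * P 0).
  apply: (le_trans (ler_wpM2l (ltW d0) H1)).
  by rewrite mulrCA (mass_kdiff kP d0) ler_wpM2l.
have H5 : M * \int[leb]_s khead P d s <= M * (d * P 0) by rewrite ler_wpM2l.
lra.
Qed.

(** Since [f] has the sign of [u] and [k * |f|] does not exceed [|u|], the subtraction never crosses
    0, and the modulus acts linearly. *)
Lemma norm_sub_mono (R : realType) (u f c k : R) : 0 <= k -> k * c <= 1 ->
  0 <= f * u -> `|f| <= c * `|u| -> `|u - k * f| = `|u| - k * `|f|.
Proof.
move=> k0 kc fu fc.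
have kf : k * `|f| <= `|u|.
  apply: (le_trans (ler_wpM2l k0 fc)); rewrite mulrA -[leRHS]mul1r.
  by rewrite ler_wpM2r.
have [u0|u0|u0] := ltgtP u 0.
- have f0 : f <= 0 by rewrite -(@nmulr_lge0 _ u).
  move: kf; rewrite (ltr0_norm u0) (ler0_norm f0) => kf.
  by rewrite ler0_norm; lra.
- have f0 : 0 <= f by rewrite -(@pmulr_lge0 _ u).
  move: kf; rewrite (gtr0_norm u0) (ger0_norm f0) => kf.
  by rewrite ger0_norm; lra.
- move: fc; rewrite u0 normr0 mulr0 normr_le0 => /eqP ->.
  by rewrite mulr0 subr0 normr0 mulr0 subr0.
Qed.

(* The space increment [d = tau^2] makes the errors linear in [d] second order in time. *)
Lemma euler_step (R : realType) (P : R -> R) (u f : R -> R -> R) (L F c t1 t2 a : R) :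
  is_kernel P -> 0 <= L -> lip2 L u -> lip2 L f -> (forall z t, `|f z t| <= F) ->
  (forall z t, 0 <= f z t * u z t) -> (forall z t, `|f z t| <= c * `|u z t|) -> 0 <= c ->
  slab_balance u (fun z t => avg P (fun x => f x t) z) ->
  0 <= t1 -> t1 < t2 -> t2 - t1 <= 1 -> (t2 - t1) * P 0 * c <= 1 ->
  forall d, d = (t2 - t1) ^+ 2 ->
  `|u a t2| + (t2 - t1) * (\int[leb]_s kdiff P d s) * `|f a t1| <=
  `|u a t1| + (t2 - t1) * \int[leb]_s (kdiff P d s * `|f (a + s) t1|)
    + (3 * P 0 * L + 2 * L) * (t2 - t1) ^+ 2.
Proof.
move=> kP L0 Lu Lf fF fu fc c0 bal t10 t12 t1le cfl d.
set tau := t2 - t1 in t1le cfl * => dE.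
have tau0 : 0 < tau by rewrite subr_gt0.
have d0 : 0 < d by rewrite dE exprn_gt0.
have P0 := kernel_ge0 kP 0.
have mf t := lip2_measurable1 t L0 Lf.
pose B z t := avg P (fun x => f x t) z.
have LB : lip2 L B by exact: avg_lip2 kP L0 Lf fF.
(* The increment in time is taken first and averaged afterwards, so [avg_increment_le] supplies the
   factor [d] needed in [euler_increment]. *)
have BK t : `|(B (a + d) t - B a t) - (B (a + d) t1 - B a t1)| <= d * (2 * P 0 * L) * `|t - t1|.
  pose h x := f x t - f x t1.
  have mh : measurable_fun [set: R] h by exact: measurable_funB.
  have hL x : `|h x| <= L * `|t - t1|.
    by have := Lf x x t t1; rewrite subrr normr0 add0r.
  have hE z : B z t - B z t1 = avg P h z.
    by rewrite (avgB _ _ kP (mf t) (mf t1) (fun x => fF x t) (fun x => fF x t1)).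
  have -> : B (a + d) t - B a t - (B (a + d) t1 - B a t1) = avg P h (a + d) - avg P h a.
    by rewrite -!hE; ring.
  by have := avg_increment_le a kP d0 mh hL; rewrite !mulrA.
have K0 : 0 <= 2 * P 0 * L by rewrite !mulr_ge0.
have H1 := euler_increment L0 K0 Lu (fun z => lip2_measurable2 z L0 LB) bal t10 t12 d0 BK.
rewrite -/tau -dE in H1.
pose I := \int[leb]_s (kdiff P d s * f (a + s) t1).
pose m := \int[leb]_s kdiff P d s.
pose Hd := \int[leb]_s (khead P d s * f (a + s) t1).
have DE : B (a + d) t1 - B a t1 = d * I - Hd.
  exact: (avg_increment a kP d0 (mf t1) (fun x => fF x t1)).
have mk := mass_kdiff kP d0.
have mle := mass_khead_le kP d0.
have m0 : 0 <= m by apply: Rintegral_ge0 => s _; exact: kdiff_ge0.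
have mP : m <= P 0 by rewrite -(ler_pM2l d0) mk.
have mha := measurable_shift a (mf t1).
(* The head sees [f] only on [[a, a + d)], within [L * d] of [f a t1]; replacing it by that value
   yields the local loss term, with mass [d * m] by [mk]. *)
have H2 : `|Hd - d * m * f a t1| <= L * d * (d * P 0).
  rewrite mk -RintegralZr//; last exact: integrable_khead.
  have i1 := integrable_bddM (integrable_khead d kP) mha (fun s => fF (a + s) t1).
  have i2 := integrable_bddM (integrable_khead d kP) (measurable_cst (f a t1)) (fun s => fF a t1).
  rewrite /Hd -RintegralB//.
  under eq_Rintegral do rewrite -mulrBr.
  apply: (@le_trans _ _ (L * d * \int[leb]_s khead P d s)); last first.
    by rewrite ler_wpM2l// mulr_ge0// ltW.
  apply: norm_kintegral_le; first exact: integrable_khead.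
  - by move=> s; exact: khead_ge0.
  - exact: measurable_funB.
  - move=> s; rewrite /khead; case: ifPn => [/andP[s0 sd] _|]; last by rewrite eqxx.
    have := Lf (a + s) a t1 t1; rewrite subrr normr0 addr0 => /le_trans; apply.
    by rewrite ler_wpM2l// [a + s]addrC addrK ger0_norm// ltW.
have H3 : `|I| <= \int[leb]_s (kdiff P d s * `|f (a + s) t1|).
  have mk' := measurable_kdiff d kP.
  apply: leb_norm_le.
  - exact: measurable_funM.
  - by move=> s; rewrite normrM (ger0_norm (kdiff_ge0 s kP d0)).
  - apply: (integrable_bddM (integrable_kdiff kP d0) _ (M := F)).
      exact: measurableT_comp.
    by move=> s; rewrite normr_id.
have km : tau * m * c <= 1.
  by apply: le_trans cfl; rewrite ler_wpM2r// ler_wpM2l// ltW.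
have km0 : 0 <= tau * m by rewrite mulr_ge0// ltW.
have H4 := norm_sub_mono km0 km (fu a t1) (fc a t1).
set J := \int[leb]_s (kdiff P d s * `|f (a + s) t1|) in H3 *.
rewrite -/m.
(* Four pieces: the sign-preserving local part, the nonlocal gain, the Euler remainder, and the
   error of localising the head. *)
have E : u a t2 = (u a t1 - tau * m * f a t1) + tau * I
   + (u a t2 - u a t1 - tau * ((d * I - Hd) / d)) - tau / d * (Hd - d * m * f a t1).
  by field; lra.
rewrite -DE in E.
have N1 := ler_normB ((u a t1 - tau * m * f a t1) + tau * I
   + (u a t2 - u a t1 - tau * ((B (a + d) t1 - B a t1) / d))) (tau / d * (Hd - d * m * f a t1)).
rewrite -E in N1.
have N2 := ler_normD ((u a t1 - tau * m * f a t1) + tau * I)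
   (u a t2 - u a t1 - tau * ((B (a + d) t1 - B a t1) / d)).
have N3 := ler_normD (u a t1 - tau * m * f a t1) (tau * I).
rewrite normrM (gtr0_norm tau0) in N3.
have N4 : `|tau / d * (Hd - d * m * f a t1)| <= L * P 0 * d.
  rewrite normrM gtr0_norm ?divr_gt0//.
  apply: (@le_trans _ _ (tau / d * (L * d * (d * P 0)))).
    by rewrite ler_wpM2l// divr_ge0 ?ltW.
  have -> : tau / d * (L * d * (d * P 0)) = tau * (L * P 0 * d) by field; lra.
  by rewrite ler_piMl// !mulr_ge0// ltW.
have N5 : tau * `|I| <= tau * J by rewrite ler_wpM2l// ltW.
have H1' : `|u a t2 - u a t1 - tau * ((B (a + d) t1 - B a t1) / d)| <= 2 * P 0 * L * d + 2 * L * d.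
  exact: H1.
rewrite -dE.
move: N1 N2 N3 N4 N5 H1' H4; clear.
set n1 := `|_ + _ - _|; lra.
Qed.

(** * Weighted integrals of the Euler step *)

Lemma EFin_Rintegral (R : realType) (f : R -> R) :
  leb.-integrable [set: R] (EFin \o f) -> ((\int[leb]_x f x)%:E = \int[leb]_x (f x)%:E)%E.
Proof. by move=> fi; rewrite /Rintegral fineK//; exact: (integrable_fin_num measurableT fi). Qed.

Lemma measurable_corr (R : realType) (p F : R -> R) (M : R) :
  leb.-integrable [set: R] (EFin \o p) -> (forall s, 0 <= p s) ->
  measurable_fun [set: R] F -> (forall x, 0 <= F x <= M) ->
  measurable_fun [set: R] (fun a => \int[leb]_s (p s * F (a + s))).
Proof.
move=> ip p0 mF FM.
have mp : measurable_fun [set: R] p by apply/measurable_EFinP; exact: (measurable_int _ ip).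
have FM' x : `|F x| <= M by have /andP[? ?] := FM x; rewrite ger0_norm.
pose g (q : R * R) := (p q.2 * F (q.1 + q.2))%:E.
have mg : measurable_fun [set: R * R] g.
  apply/measurable_EFinP; apply: measurable_funM; first exact: (measurableT_comp mp measurable_snd).
  apply: (measurableT_comp mF); exact: measurable_funD measurable_fst measurable_snd.
have g0 q : (0 <= g q)%E by rewrite lee_fin mulr_ge0//; case/andP: (FM (q.1 + q.2)).
have := measurable_fun_fubini_tonelli_F (m2 := leb) g mg g0.
rewrite /fubini_F => H; apply/measurable_EFinP.
rewrite (_ : EFin \o _ = (fun x => \int[leb]_y g (x, y))%E)//.
apply/funext => a /=; rewrite EFin_Rintegral//.
exact: (integrable_bddM ip (measurable_shift a mF) (fun s => FM' (a + s))).
Qed.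

(** Tonelli and a translation move the shift from [F] to the weight [rho]. Integrating the assumed
    growth [J + s * Q] against [p] produces its mass times [J] and its first moment times [Q]. *)
Lemma weighted_corr_le (R : realType) (rho p F : R -> R) (M J Q m c : R) :
  leb.-integrable [set: R] (EFin \o rho) -> (forall s, 0 <= rho s) ->
  leb.-integrable [set: R] (EFin \o p) -> (forall s, 0 <= p s) ->
  leb.-integrable [set: R] (EFin \o (fun s => s * p s)) -> (forall s, s < 0 -> p s = 0) ->
  measurable_fun [set: R] F -> (forall x, 0 <= F x <= M) ->
  \int[leb]_s p s = m -> \int[leb]_s (s * p s) <= c -> 0 <= Q ->
  (forall s, 0 <= s -> \int[leb]_x (rho (x - s) * F x) <= J + s * Q) ->
  \int[leb]_a (rho a * \int[leb]_s (p s * F (a + s))) <= m * J + c * Q.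
Proof.
move=> ir r0 ip p0 isp pneg mF FM mE sc Q0 HJ.
have F0 x : 0 <= F x by case/andP: (FM x).
have FM' x : `|F x| <= M by have /andP[? ?] := FM x; rewrite ger0_norm.
have mp : measurable_fun [set: R] p by apply/measurable_EFinP; exact: (measurable_int _ ip).
have mr : measurable_fun [set: R] rho by apply/measurable_EFinP; exact: (measurable_int _ ir).
pose g (q : R * R) := (rho q.1 * (p q.2 * F (q.1 + q.2)))%:E.
have mg : measurable_fun [set: R * R] g.
  apply/measurable_EFinP; apply: measurable_funM; first exact: (measurableT_comp mr measurable_fst).
  apply: measurable_funM; first exact: (measurableT_comp mp measurable_snd).
  apply: (measurableT_comp mF); exact: measurable_funD measurable_fst measurable_snd.
have g0 q : (0 <= g q)%E by rewrite lee_fin !mulr_ge0.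
have Lh : (\int[leb]_a (rho a * \int[leb]_s (p s * F (a + s)))%:E =
    \int[leb]_a \int[leb]_s g (a, s))%E.
  apply: eq_integral => a _.
  have i1 := integrable_bddM ip (measurable_shift a mF) (fun s => FM' (a + s)).
  by rewrite -RintegralZl// EFin_Rintegral//; exact: integrable_scale.
have Ub : (\int[leb]_a (rho a * \int[leb]_s (p s * F (a + s)))%:E <= (m * J + c * Q)%:E)%E.
  rewrite Lh (fubini_tonelli (m1 := leb) (m2 := leb) g mg g0).
  apply: (@le_trans _ _ (\int[leb]_s (J * p s + Q * (s * p s))%:E)%E); last first.
    rewrite -EFin_Rintegral; last first.
      by apply: integrable_add => //; exact: integrable_scale.
    rewrite lee_fin RintegralD//; try exact: integrable_scale.
    rewrite !RintegralZl// mE mulrC lerD2l mulrC.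
    by rewrite ler_wpM2r.
  apply: ge0_le_integral => //.
  - by move=> s _; apply: integral_ge0 => a _; exact: g0.
  - exact: measurable_fun_fubini_tonelli_G.
  - by apply/measurable_EFinP; apply: measurable_funD; apply: measurable_funM => //;
      exact: measurable_funM.
  move=> s _.
  have [s0|s0] := ltP s 0.
    rewrite (eq_integral (fun _ => 0%E)); last by move=> a _; rewrite /g/= pneg// mul0r mulr0.
    by rewrite integral0 pneg// !mulr0 addr0.
  have irF : leb.-integrable [set: R] (EFin \o (fun x => rho (x - s) * F x)).
    exact: (integrable_bddM (integrable_shift (- s) ir) mF FM').
  have -> : (\int[leb]_a g (a, s) = (p s * \int[leb]_x (rho (x - s) * F x))%:E)%E.
    rewrite -(Rintegral_shift s irF) -RintegralZl//; last exact: (integrable_shift s irF).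
    rewrite EFin_Rintegral; last first.
      by apply: integrable_scale => //; exact: (integrable_shift s irF).
    by apply: eq_integral => a _; rewrite /g /= addrK; congr EFin; ring.
  rewrite lee_fin (_ : J * p s + Q * (s * p s) = p s * (J + s * Q)); last ring.
  by rewrite ler_wpM2l// HJ.
rewrite /Rintegral -lee_fin fineK//.
rewrite ge0_fin_numE; first exact: le_lt_trans Ub (ltry _).
apply: integral_ge0 => a _; rewrite lee_fin mulr_ge0//.
by apply: Rintegral_ge0 => s _; rewrite mulr_ge0.
Qed.

(** The part [m * J] of the gain cancels the loss exactly. What remains is [Q] times the first
    moment [1 + d * P 0]: the 1 gives the linear term, and [d * P 0] joins the quadratic remainder
    because the step is at most 1. *)
Lemma weighted_step (R : realType) (P : R -> R) (u f : R -> R -> R) (rho : R -> R)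
    (L F M c t1 t2 Q : R) :
  is_kernel P -> 0 <= L -> lip2 L u -> lip2 L f -> (forall z t, `|f z t| <= F) ->
  (forall z t, `|u z t| <= M) ->
  (forall z t, 0 <= f z t * u z t) -> (forall z t, `|f z t| <= c * `|u z t|) -> 0 <= c ->
  slab_balance u (fun z t => avg P (fun x => f x t) z) ->
  0 <= t1 -> t1 < t2 -> t2 - t1 <= 1 -> (t2 - t1) * P 0 * c <= 1 ->
  leb.-integrable [set: R] (EFin \o rho) -> (forall s, 0 <= rho s) ->
  0 <= Q -> (forall s, 0 <= s -> \int[leb]_x (rho (x - s) * `|f x t1|) <=
    \int[leb]_x (rho x * `|f x t1|) + s * Q) ->
  \int[leb]_a (rho a * `|u a t2|) <= \int[leb]_a (rho a * `|u a t1|) + (t2 - t1) * Q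
    + (P 0 * Q + (3 * P 0 * L + 2 * L) * \int[leb]_a rho a) * (t2 - t1) ^+ 2.
Proof.
move=> kP L0 Lu Lf fF uM fu fc c0 bal t10 t12 t1le cfl ir r0 Q0 HQ.
set tau := t2 - t1 in t1le cfl *.
have tau0 : 0 < tau by rewrite subr_gt0.
pose d := tau ^+ 2.
have d0 : 0 < d by rewrite exprn_gt0.
pose m := \int[leb]_s kdiff P d s.
have P0 := kernel_ge0 kP 0.
have mf : measurable_fun [set: R] (fun x => `|f x t1|).
  by apply: measurableT_comp => //; exact: lip2_measurable1 L0 Lf.
have fF' x : 0 <= `|f x t1| <= F by rewrite normr_ge0 fF.
have [isp sple] := moment_kdiff kP d0.
have W := weighted_corr_le ir r0 (integrable_kdiff kP d0) (fun s => kdiff_ge0 s kP d0) isp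
  (fun s s0 => kdiff_neg P d0 s0) mf fF' (erefl m) sple Q0 HQ.
pose G a := \int[leb]_s (kdiff P d s * `|f (a + s) t1|).
have mG : measurable_fun [set: R] G.
  exact: (measurable_corr (integrable_kdiff kP d0) (fun s => kdiff_ge0 s kP d0) mf fF').
have m0 : 0 <= m by apply: Rintegral_ge0 => s _; exact: kdiff_ge0.
have GF a : `|G a| <= F * m.
  apply: norm_kintegral_le; first exact: integrable_kdiff.
  - by move=> s; exact: kdiff_ge0.
  - exact: (measurable_shift a mf).
  - by move=> s _; rewrite normr_id.
have iru t : leb.-integrable [set: R] (EFin \o (fun a => rho a * `|u a t|)).
  apply: (integrable_bddM ir _ (M := M)); last by move=> x; rewrite normr_id.
  by apply: measurableT_comp => //; exact: lip2_measurable1 L0 Lu.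
have irf : leb.-integrable [set: R] (EFin \o (fun a => rho a * `|f a t1|)).
  by apply: (integrable_bddM ir mf (M := F)) => x; rewrite normr_id.
have irG := integrable_bddM ir mG GF.
pose E := (3 * P 0 * L + 2 * L) * tau ^+ 2.
have step a : rho a * `|u a t2| + tau * m * (rho a * `|f a t1|) <=
    rho a * `|u a t1| + (tau * (rho a * G a) + E * rho a).
  have := euler_step a kP L0 Lu Lf fF fu fc c0 bal t10 t12 t1le cfl (erefl d).
  rewrite -/tau -/m -/(G a) -/E => H.
  have := ler_wpM2l (r0 a) H; lra.
have I1 := integrable_add measurableT (iru t2) (integrable_scale (tau * m) measurableT irf).
have I3 := integrable_add measurableT (integrable_scale tau measurableT irG)
  (integrable_scale E measurableT ir).
have I2 := integrable_add measurableT (iru t1) I3.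
have := le_Rintegral measurableT I1 I2 (fun x _ => step x).
rewrite RintegralD//; last exact: integrable_scale.
rewrite RintegralD// RintegralD//; try exact: integrable_scale.
rewrite !RintegralZl//.
set J := \int[leb]_x (rho x * `|f x t1|) in W *.
set K := \int[leb]_x (rho x * G x) => H.
have W' : K <= m * J + (1 + d * P 0) * Q by exact: W.
have HK : tau * K <= tau * (m * J + (1 + d * P 0) * Q) by rewrite ler_wpM2l// ltW.
have tQ : tau * (d * P 0 * Q) <= tau ^+ 2 * P 0 * Q.
  by rewrite -/d -mulrA ler_piMl// !mulr_ge0// ltW.
move: H HK tQ; rewrite /E; clear; lra.
Qed.

(** * Tent weights and the contraction *)

Lemma exists_fine_step (R : realType) (T h : R) : 0 < T -> 0 < h ->
  exists n : nat, T / n.+1%:R <= h.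
Proof.
move=> T0 h0; exists (Num.truncn (T / h)).
rewrite ler_pdivrMr ?ltr0n// mulrC -ler_pdivrMr//.
exact: (ltW (truncnS_gt _)).
Qed.

(** Over equal steps of length [tau] the linear terms add up to [T * Q] and the quadratic ones to
    [C * T * tau], which is below any prescribed [e] once [tau <= e / (C * T + 1)]. *)
Lemma euler_iterate (R : realType) (I : R -> R) (T Q C h : R) : 0 < T -> 0 < h -> 0 <= C ->
  (forall t1 t2, 0 <= t1 -> t1 < t2 -> t2 <= T -> t2 - t1 <= h ->
    I t2 <= I t1 + (t2 - t1) * Q + C * (t2 - t1) ^+ 2) ->
  I T <= I 0 + T * Q.
Proof.
move=> T0 h0 C0 step; apply/ler_addgt0Pr => e e0.
have CT : 0 < C * T + 1 by rewrite ltr_wpDl// mulr_ge0// ltW.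
have he : 0 < Num.min h (e / (C * T + 1)) by rewrite lt_min h0 divr_gt0.
have [n] := exists_fine_step T0 he.
rewrite le_min; set tau := T / n.+1%:R => /andP[th te].
have tau0 : 0 < tau by rewrite divr_gt0// ltr0n.
have nT : n.+1%:R * tau = T by rewrite mulrC divfK// pnatr_eq0.
have H k : (k <= n.+1)%N -> I (k%:R * tau) <= I 0 + k%:R * tau * Q + k%:R * (C * tau ^+ 2).
  elim: k => [|k IH kn]; first by rewrite !mul0r !addr0.
  have kT : k.+1%:R * tau <= T by rewrite -nT ler_wpM2r ?(ltW tau0)// ler_nat.
  have E : k.+1%:R * tau - k%:R * tau = tau by rewrite -mulrBl -natrB ?leqnSn// subSnn mul1r.
  have := step (k%:R * tau) (k.+1%:R * tau).
  rewrite E => /(_ _ _ kT th) H.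
  apply: (le_trans (H _ _)).
  - by rewrite mulr_ge0// ltW.
  - by rewrite ltr_pM2r// ltr_nat.
  have := IH (ltnW kn); rewrite -natr1; lra.
have := H n.+1 (leqnn _); rewrite nT => /le_trans; apply.
rewrite lerD2l expr2 mulrCA [n.+1%:R * _]mulrA nT.
apply: (@le_trans _ _ ((C * T + 1) * tau)); first by lra.
by rewrite mulrC -ler_pdivlMr.
Qed.

(** Compact support makes weighted integrals of bounded functions finite before any integrability is
    known; the slope [1 / N] controls the cost of a shift. *)
Definition tent {R : realType} (N z : R) := Num.max 0 (1 - `|z| / N).

Lemma tent_ge0 (R : realType) (N z : R) : 0 <= tent N z.
Proof. by rewrite /tent le_max lexx. Qed.

Lemma tent_le_indic (R : realType) (N z : R) : 0 < N ->
  tent N z <= \1_(`[- N, N]%classic : set R) z.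
Proof.
move=> N0; rewrite indicE /tent.
have [zN|zN] := leP `|z| N.
  rewrite mem_set; last by rewrite /= in_itv/= -ler_norml.
  by rewrite ge_max ler01/= lerBlDr lerDl divr_ge0// ltW.
by rewrite ge_max ler0n/= (le_trans _ (ler0n _ _))// subr_le0 ler_pdivlMr// mul1r ltW.
Qed.

Lemma measurable_tent (R : realType) (N : R) : measurable_fun [set: R] (tent N).
Proof.
apply: measurable_maxr => //; apply: measurable_funB => //.
by apply: measurable_funM => //; exact: measurableT_comp.
Qed.

Lemma integrable_tent (R : realType) (N : R) : 0 < N ->
  leb.-integrable [set: R] (EFin \o tent N).
Proof.
move=> N0; apply: (leb_dominated (g := \1_(`[- N, N]%classic : set R)) (measurable_tent N)).
  by move=> z; rewrite ger0_norm ?tent_ge0// tent_le_indic.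
exact: (integrable_indic_itv (- N) N true false).
Qed.

Lemma tent_lip (R : realType) (N x s : R) : 0 < N -> 0 <= s -> tent N (x - s) <= tent N x + s / N.
Proof.
move=> N0 s0; have sN : 0 <= s / N by rewrite divr_ge0// ltW.
rewrite /tent ge_max; apply/andP; split; first by rewrite addr_ge0// le_max lexx.
apply: (@le_trans _ _ (1 - `|x| / N + s / N)); last by rewrite lerD2r le_max lexx orbT.
have : (`|x| - s) / N <= `|x - s| / N.
  by rewrite ler_wpM2r ?invr_ge0 ?(ltW N0)// -{1}(ger0_norm s0) lerB_dist.
lra.
Qed.

(** For [s <= N] the shift costs [s / N] on [[- N, 2 * N]], an interval of length [3 * N]. For
    [s > N] the shifted integral is at most [2 * N * M], already below [3 * s * M]. The bound is
    free of [N] either way. *)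
Lemma tent_shift_bounded (R : realType) (N s M : R) (F : R -> R) : 0 < N -> 0 <= s ->
  measurable_fun [set: R] F -> (forall x, 0 <= F x <= M) ->
  \int[leb]_x (tent N (x - s) * F x) <= \int[leb]_x (tent N x * F x) + s * (3 * M).
Proof.
move=> N0 s0 mF FM.
have FM' x : `|F x| <= M by have /andP[? ?] := FM x; rewrite ger0_norm.
have F0 x : 0 <= F x by case/andP: (FM x).
have M0 : 0 <= M := le_trans (F0 0) (le_trans (ler_norm _) (FM' 0)).
have i1 := integrable_bddM (integrable_tent N0) mF FM'.
have i2 := integrable_bddM (integrable_shift (- s) (integrable_tent N0)) mF FM'.
have I0 : 0 <= \int[leb]_x (tent N x * F x).
  by apply: Rintegral_ge0 => x _; rewrite mulr_ge0 ?tent_ge0.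
have [sN|sN] := leP s N.
  have N3 : - N <= 2 * N by lra.
  have ii := integrable_indicM (s / N * M) N3.
  apply: (@le_trans _ _ (\int[leb]_x (tent N x * F x + s / N * M * \1_(`[- N, 2 * N]%classic : set R) x))).
    apply: le_Rintegral => //; first exact: integrable_add.
    move=> x _; rewrite indicE.
    have sNM : 0 <= s / N * M by rewrite mulr_ge0// divr_ge0// ltW.
    have [xin|xin] := boolP (- N <= x <= 2 * N).
      rewrite mem_set ?mulr1; last by rewrite /= in_itv/= xin.
      apply: (@le_trans _ _ ((tent N x + s / N) * F x)); first by rewrite ler_wpM2r// tent_lip.
      by rewrite mulrDl lerD2l ler_wpM2l ?divr_ge0 ?(ltW N0)//; case/andP: (FM x).
    rewrite [tent N (x - s)](_ : _ = 0).
      by rewrite mul0r addr_ge0// mulr_ge0 ?tent_ge0 ?ler0n.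
    apply: le_anti; rewrite tent_ge0 andbT (le_trans (tent_le_indic _ N0))//.
    rewrite indicE memNset//= in_itv/= => /andP[? ?]; move/negP: xin; apply.
    by apply/andP; split; lra.
  rewrite RintegralD// Rintegral_indicM// lerD2l.
  by rewrite (_ : s / N * M * (2 * N - - N) = s * (3 * M))//; field; lra.
have NN : - N + s <= N + s by lra.
apply: (@le_trans _ _ (\int[leb]_x (M * \1_(`[- N + s, N + s]%classic : set R) x))).
  apply: le_Rintegral => //; first exact: integrable_indicM.
  move=> x _; rewrite mulrC ler_pM ?tent_ge0//; first by case/andP: (FM x).
  apply: (le_trans (tent_le_indic _ N0)); rewrite !indicE.
  have [xin|xin] := boolP (x - s \in `[- N, N]%classic); last by rewrite ler0n.
  rewrite mem_set//; move: xin; rewrite inE/= !in_itv/= => /andP[? ?].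
  by apply/andP; split; lra.
rewrite Rintegral_indicM//.
have : M * N <= M * s by rewrite ler_wpM2l// ltW.
have Ms : 0 <= M * s by rewrite mulr_ge0.
move: I0 Ms; lra.
Qed.

Lemma tent_shift_integrable (R : realType) (N s A : R) (F : R -> R) : 0 < N -> 0 <= s ->
  (forall x, 0 <= F x) -> leb.-integrable [set: R] (EFin \o F) -> \int[leb]_x F x <= A ->
  \int[leb]_x (tent N (x - s) * F x) <= \int[leb]_x (tent N x * F x) + s * (A / N).
Proof.
move=> N0 s0 F0 iF FA.
have t1 x : `|tent N x| <= 1.
  rewrite ger0_norm ?tent_ge0// (le_trans (tent_le_indic _ N0))// indicE.
have i1 : leb.-integrable [set: R] (EFin \o (fun x => tent N x * F x)).
  have := integrable_bddM iF (measurable_tent N) t1.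
  by apply: eq_integrable => // x _; rewrite /= mulrC.
have i2 : leb.-integrable [set: R] (EFin \o (fun x => tent N (x - s) * F x)).
  have mt : measurable_fun [set: R] (fun x => tent N (x - s)).
    by apply: (measurableT_comp (measurable_tent N)); exact: measurable_funB.
  have := integrable_bddM iF mt (fun x => t1 (x - s)).
  by apply: eq_integrable => // x _; rewrite /= mulrC.
have i3 := integrable_scale (s / N) measurableT iF.
apply: (@le_trans _ _ (\int[leb]_x (tent N x * F x + s / N * F x))).
  apply: le_Rintegral => //; first exact: integrable_add.
  by move=> x _; rewrite -mulrDl ler_wpM2r// tent_lip.
rewrite RintegralD// lerD2l RintegralZl// (_ : s * (A / N) = s / N * A); last by ring.
by rewrite ler_wpM2l// divr_ge0// ltW.
Qed.

(** Tents increase pointwise to 1, so monotone convergence applies. Extended real integrals are used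
    because finiteness is to be concluded, not assumed. *)
Lemma tent_exhaustion (R : realType) (g : R -> R) (A : R) :
  measurable_fun [set: R] g -> (forall x, 0 <= g x) ->
  (forall n : nat, (\int[leb]_x (tent n.+1%:R x * g x)%:E <= A%:E)%E) ->
  (\int[leb]_x (g x)%:E <= A%:E)%E.
Proof.
move=> mg g0 H.
pose h n x := (tent n.+1%:R x * g x)%:E.
have mh n : measurable_fun [set: R] (h n).
  by apply/measurable_EFinP; apply: measurable_funM => //; exact: measurable_tent.
have h0 n x : [set: R] x -> (0 <= h n x)%E by rewrite lee_fin mulr_ge0// tent_ge0.
have nd x : [set: R] x -> nondecreasing_seq (h ^~ x).
  move=> _ n k nk; rewrite lee_fin ler_wpM2r// /tent ge_max le_max lexx/=.
  rewrite le_max; apply/orP; right; rewrite lerB// ler_wpM2l// lef_pV2 ?posrE ?ltr0n//.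
  by rewrite ler_nat.
have hl x : h n x @[n --> \oo] --> (g x)%:E.
  apply: cvg_EFin; first by near=> n.
  rewrite -[X in _ --> X]mul1r; apply: cvgM; last exact: cvg_cst.
  apply: (@squeeze_cvgr _ _ _ _ (fun n => 1 - `|x| * harmonic n) (fun _ => 1)).
  - near=> n; rewrite /= (le_trans (tent_le_indic _ _)) ?ltr0n// ?andbT.
      by rewrite /tent le_max lexx orbT.
  - rewrite -[X in _ --> X](subr0 1) -[X in _ - X](mulr0 `|x|).
    apply: cvgB; first exact: cvg_cst.
    by apply: cvgM; [exact: cvg_cst | exact: cvg_harmonic].
  - exact: cvg_cst.
have -> : (\int[leb]_x (g x)%:E = \int[leb]_x limn (h ^~ x))%E.
  by apply: eq_integral => x _; apply/esym/cvg_lim => //; exact: hl.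
rewrite (monotone_convergence leb measurableT mh h0 nd).
apply: lime_le; last by near=> n; exact: H.
apply: ereal_nondecreasing_is_cvgn => n k nk; apply: ge0_le_integral => //.
- by move=> x Dx; exact: h0.
- exact: mh.
- exact: mh.
- by move=> x Dx; exact: (nd x Dx n k nk).
Unshelve. all: by end_near. Qed.

(** Of the two solutions only their difference [u] and the flux difference [f] are kept; the
    nonlinearity survives as the sign condition and the linear bound by [c]. *)
Record transport {R : realType} (P : R -> R) (u f : R -> R -> R) (L F M c : R) : Prop := Transport {
  transport_kernel : is_kernel P;
  transport_L0 : 0 <= L;
  transport_lipu : lip2 L u;
  transport_lipf : lip2 L f;
  transport_bndf : forall z t, `|f z t| <= F;
  transport_bndu : forall z t, `|u z t| <= M;
  transport_sign : forall z t, 0 <= f z t * u z t;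
  transport_le : forall z t, `|f z t| <= c * `|u z t|;
  transport_c0 : 0 <= c;
  transport_balance : slab_balance u (fun z t => avg P (fun x => f x t) z) }.

Lemma tent_evolution (R : realType) (P : R -> R) (u f : R -> R -> R) (L F M c N Q T : R) :
  transport P u f L F M c -> 0 < N -> 0 <= Q -> 0 < T ->
  (forall t s, 0 <= t -> t < T -> 0 <= s -> \int[leb]_x (tent N (x - s) * `|f x t|) <=
    \int[leb]_x (tent N x * `|f x t|) + s * Q) ->
  \int[leb]_a (tent N a * `|u a T|) <= \int[leb]_a (tent N a * `|u a 0|) + T * Q.
Proof.
move=> [kP L0 Lu Lf fF uM fu fc c0 bal] N0 Q0 T0 HQ.
have P0 := kernel_ge0 kP 0.
have Pc : 0 < P 0 * c + 1 by rewrite ltr_wpDl// mulr_ge0.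
(* Steps of this size are at most 1 and satisfy [tau * P 0 * c <= 1]; the added 1 covers
   [P 0 * c = 0]. *)
pose h := Num.min 1 (P 0 * c + 1)^-1.
have h0 : 0 < h by rewrite lt_min ltr01 invr_gt0.
have I0 : 0 <= \int[leb]_a tent N a by apply: Rintegral_ge0 => x _; exact: tent_ge0.
have C0 : 0 <= P 0 * Q + (3 * P 0 * L + 2 * L) * \int[leb]_a tent N a.
  by rewrite addr_ge0 ?mulr_ge0 ?addr_ge0// ?mulr_ge0.
apply: (euler_iterate T0 h0 C0 (I := fun t => \int[leb]_a (tent N a * `|u a t|))).
move=> t1 t2 t10 t12 t2T; rewrite le_min => /andP[tle1 tleh].
apply: (weighted_step kP L0 Lu Lf fF uM fu fc c0 bal t10 t12 tle1).
- have Pc0 : 0 <= P 0 * c by rewrite mulr_ge0.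
  rewrite -mulrA; apply: (@le_trans _ _ ((P 0 * c + 1)^-1 * (P 0 * c))).
    by rewrite ler_wpM2r.
  by rewrite mulrC ler_pdivrMr// mul1r lerDl.
- exact: integrable_tent.
- by move=> s; exact: tent_ge0.
- exact: Q0.
- by move=> s s0; apply: HQ => //; exact: lt_le_trans t12 t2T.
Qed.

Lemma Rintegral_le_of_integral (R : realType) (g : R -> R) (A : R) :
  measurable_fun [set: R] g -> (forall x, 0 <= g x) ->
  (\int[leb]_x (g x)%:E <= A%:E)%E ->
  leb.-integrable [set: R] (EFin \o g) /\ \int[leb]_x g x <= A.
Proof.
move=> mg g0 gA.
have ig : leb.-integrable [set: R] (EFin \o g).
  apply/integrableP; split; first exact/measurable_EFinP.
  apply: le_lt_trans (ltry A); apply: le_trans gA.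
  by under eq_integral do rewrite /= ger0_norm//.
by split => //; rewrite -lee_fin EFin_Rintegral.
Qed.

Lemma l1_contraction (R : realType) (P : R -> R) (u f : R -> R -> R) (L F M c A T : R) :
  transport P u f L F M c -> (\int[leb]_x (`|u x 0|)%:E <= A%:E)%E -> 0 < T ->
  (\int[leb]_x (`|u x T|)%:E <= A%:E)%E.
Proof.
move=> tr u0A T0; have [kP L0 Lu Lf fF uM fu fc c0 bal] := tr.
have mu t : measurable_fun [set: R] (fun x => `|u x t|).
  by apply: measurableT_comp => //; exact: lip2_measurable1 L0 Lu.
have mf t : measurable_fun [set: R] (fun x => `|f x t|).
  by apply: measurableT_comp => //; exact: lip2_measurable1 L0 Lf.
have F0 : 0 <= F := le_trans (normr_ge0 _) (fF 0 0).
have uM' x t : `| `|u x t| | <= M by rewrite normr_id.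
have [iu0 u0A'] := Rintegral_le_of_integral (mu 0) (fun x => normr_ge0 _) u0A.
have itu N t : 0 < N -> leb.-integrable [set: R] (EFin \o (fun x => tent N x * `|u x t|)).
  by move=> N0; exact: (integrable_bddM (integrable_tent N0) (mu t) (fun x => uM' x t)).
have tle1 N x : 0 < N -> tent N x <= 1.
  by move=> N0; rewrite (le_trans (tent_le_indic _ N0))// indicE lern1 leq_b1.
have I0 N : 0 < N -> \int[leb]_x (tent N x * `|u x 0|) <= A.
  move=> N0; apply: le_trans u0A'; apply: le_Rintegral => //; first exact: itu.
  by move=> x _; rewrite ler_piMl// tle1.
(* A bounded [f] makes the tail error bounded in the width, so [u] is in L^1. *)
have pass1 t : 0 < t -> (\int[leb]_x (`|u x t|)%:E <= (A + t * (3 * F))%:E)%E.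
  move=> t0; apply: tent_exhaustion => // n.
  have n0 : (0 : R) < n.+1%:R by rewrite ltr0n.
  rewrite -EFin_Rintegral ?lee_fin; last exact: itu.
  apply: (le_trans (tent_evolution tr n0 _ t0 _ (Q := 3 * F))).
  - by rewrite mulr_ge0.
  - move=> t1 s _ _ s0; apply: tent_shift_bounded => // x.
    by rewrite normr_ge0 fF.
  - by rewrite lerD2r I0.
(* Taking the value at [T] makes the bound uniform over all times before [T], as the second pass
   needs. *)
pose A1 := A + T * (3 * F).
have A10 : 0 <= A1.
  rewrite addr_ge0 ?mulr_ge0// ?(ltW T0)//; apply: le_trans u0A'.
  exact: Rintegral_ge0.
have fA t : 0 <= t -> t < T ->
    leb.-integrable [set: R] (EFin \o (fun x => `|f x t|)) /\ \int[leb]_x `|f x t| <= c * A1.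
  move=> t0 tT.
  have H : (\int[leb]_x (`|u x t|)%:E <= A1%:E)%E.
    move: t0; rewrite le_eqVlt => /predU1P[<-|t0].
      by apply: (le_trans u0A); rewrite lee_fin lerDl !mulr_ge0// ltW.
    by apply: (le_trans (pass1 t t0)); rewrite lee_fin lerD2l ler_wpM2r ?mulr_ge0// ltW.
  have [iu uA] := Rintegral_le_of_integral (mu t) (fun x => normr_ge0 _) H.
  have icu := integrable_scale c measurableT iu.
  have if_ : leb.-integrable [set: R] (EFin \o (fun x => `|f x t|)).
    by apply: (leb_dominated (mf t) _ icu) => x; rewrite normr_id fc.
  split => //; apply: (@le_trans _ _ (\int[leb]_x (c * `|u x t|))).
    exact: le_Rintegral.
  by rewrite RintegralZl// ler_wpM2l.
(* With [f] in L^1 the tail error is O(1/N). *)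
have pass2 N : 0 < N -> \int[leb]_x (tent N x * `|u x T|) <= A + T * (c * A1) / N.
  move=> N0; rewrite -mulrA.
  apply: (le_trans (tent_evolution tr N0 _ T0 _ (Q := c * A1 / N))).
  - by rewrite divr_ge0 ?mulr_ge0// ltW.
  - by move=> t s t0 tT s0; have [? ?] := fA t t0 tT; apply: tent_shift_integrable.
  - by rewrite lerD2r I0.
apply: tent_exhaustion => // n.
have n0 : (0 : R) < n.+1%:R by rewrite ltr0n.
rewrite -EFin_Rintegral ?lee_fin; last exact: itu.
apply/ler_addgt0Pr => e e0.
have B0 : 0 <= T * (c * A1) by rewrite mulr_ge0 ?mulr_ge0// ltW.
(* The width is enlarged until the error is at most [e]; the wider tent dominates the given one, so
   the bound passes back to it. *)
pose N := Num.max n.+1%:R (T * (c * A1) / e).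
have nN : n.+1%:R <= N by rewrite le_max lexx.
have N0 : 0 < N by exact: lt_le_trans nN.
apply: (@le_trans _ _ (\int[leb]_x (tent N x * `|u x T|))).
  apply: le_Rintegral => //; [exact: itu | exact: itu | move=> x _].
  rewrite ler_wpM2r// /tent ge_max le_max lexx/= le_max; apply/orP; right.
  by rewrite lerB// ler_wpM2l// lef_pV2 ?posrE.
apply: (le_trans (pass2 N N0)); rewrite lerD2l ler_pdivrMr// [leRHS]mulrC -ler_pdivrMr//.
by rewrite /N le_max lexx orbT.
Qed.

(** * The data of the theorem *)

Lemma BV_bounded (R : realType) (f : R -> R) : BV_R f -> exists M, forall x, `|f x| <= M.
Proof.
move=> [M HM]; exists (`|f 0| + M) => x.
have H : `|f x - f 0| <= M.
  rewrite -lee_fin; have [x0|x0] := leP 0 x.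
    exact: le_trans (total_variation_ge f x0) (HM _ _ x0).
  rewrite distrC.
  exact: le_trans (total_variation_ge f (ltW x0)) (HM _ _ (ltW x0)).
by rewrite -(subrK (f 0) (f x)) addrC (le_trans (ler_normD _ _))// lerD.
Qed.

(** On a compact interval the Jordan decomposition writes [f] as a difference of monotone functions.
    Clamping the argument extends them monotonically to the line, and at each point the clamped
    values eventually equal those of [f]. *)
Lemma BV_measurable (R : realType) (f : R -> R) : BV_R f -> measurable_fun [set: R] f.
Proof.
move=> [M HM].
pose cl (n : nat) (x : R) := Num.max (- n%:R) (Num.min x n%:R).
have n0 n : - n%:R <= (n%:R : R) by rewrite lerNl (le_trans _ (ler0n _ _))// oppr_le0 ler0n.
have clin n x : cl n x \in `[- n%:R, n%:R].
  by rewrite in_itv/= le_max lexx/= ge_max n0/= ge_min lexx orbT.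
have clnd n x y : x <= y -> cl n x <= cl n y.
  move=> xy; rewrite /cl ge_max le_max lexx/= le_max; apply/orP; right.
  by rewrite le_min !ge_min lexx xy/= orbT.
have bv n : bounded_variation (- n%:R) n%:R f.
  apply/bounded_variationP => //; rewrite ge0_fin_numE ?total_variation_ge0//.
  exact: le_lt_trans (HM _ _ (n0 n)) (ltry _).
(* The positive variation of [f] is the negative variation of its opposite, so one monotonicity
   lemma serves both parts. *)
have bvN n : bounded_variation (- n%:R) n%:R (\- f) by exact: bounded_variationN.
apply: (@measurable_fun_cvg _ _ _ _ (fun n x => f (cl n x))).
- move=> n.
  rewrite (_ : (fun x => _) = (fun x => (fine \o pos_tv (- n%:R) f) (cl n x))
      \- (fun x => (fine \o neg_tv (- n%:R) f) (cl n x))); last first.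
    by apply/funext => x; rewrite (bounded_variation_pos_neg_tvE (bv n) (clin n x)).
  apply: measurable_funB; apply: nondecreasing_measurable => // x y xy.
    exact: (fine_neg_tv_nondecreasing (bvN n) (clin n x) (clin n y) (clnd n x y xy)).
  exact: (fine_neg_tv_nondecreasing (bv n) (clin n x) (clin n y) (clnd n x y xy)).
- move=> x _; apply: cvg_near_cst; exists (Num.truncn `|x|).+1 => // n /= xn.
  have : `|x| <= n%:R.
    by rewrite (le_trans (ltW (truncnS_gt _)))// ler_nat.
  rewrite ler_norml => /andP[x1 x2].
  by rewrite /cl (min_l x2) (max_r x1).
Qed.

(** * Reduction of the data to the abstract balance law *)

Definition kernel_ext {R : realType} (Phi : R -> R) (alpha z : R) : R :=
  if 0 <= z then kernel_scaled Phi alpha z else 0.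

Lemma nl_avgE (R : realType) (Phi h : R -> R) (alpha z : R) :
  nl_avg Phi alpha h z = avg (kernel_ext Phi alpha) h z.
Proof.
rewrite /nl_avg Rintegral_mkcond; apply: eq_Rintegral => s _.
rewrite patchE /Rnonneg /kernel_ext; case: ifPn => H.
  by rewrite ifT//; move: H; rewrite inE/= in_itv/= andbT.
by rewrite ifF ?mul0r//; apply/negbTE; move: H; rewrite notin_setE/= in_itv/= andbT => /negP.
Qed.

Lemma kernel_ext_is_kernel (R : realType) (Phi : R -> R) (alpha : R) :
  kernel_ok Phi -> 0 < alpha -> is_kernel (kernel_ext Phi alpha).
Proof.
move=> [p0 [pm [p1 pz]]] a0.
pose g z : R := if 0 <= z then Phi z else 0.
have g0 z : 0 <= g z by rewrite /g; case: ifP => // /p0.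
have mS : measurable [set x : R | 0 <= x].
  rewrite (_ : [set x : R | _] = `[0, +oo[%classic)//.
  by apply/seteqP; split => x /=; rewrite in_itv/= andbT.
have mg : measurable_fun [set: R] g.
  (* Values of [Phi] on negative arguments are arbitrary; composing with [Num.max 0] gives a
     function monotone on the whole line, hence measurable. *)
  rewrite (_ : g = (fun z => if 0 <= z then Phi (Num.max 0 z) else 0)).
    apply: (@measurable_if_le _ (fun z => Phi (Num.max 0 z)) (fun z => 0 <= z)) => //.
    apply: nonincreasing_measurable => // x y xy; apply: pm; first by rewrite le_max lexx.
    by rewrite ge_max !le_max lexx xy/= orbT.
  by apply/funext => z; rewrite /g; case: ifP => // z0; rewrite max_r.
(* The trailing [+ 0] matches the affine form of [ge0_integral_affine]. *)
have kE z : kernel_ext Phi alpha z = alpha^-1 * g (alpha^-1 * z + 0).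
  rewrite /kernel_ext /g addr0 pmulr_rge0 ?invr_gt0//.
  by case: ifP; rewrite ?mulr0// /kernel_scaled mulrC [z / _]mulrC mulrC.
have ai0 : 0 < alpha^-1 by rewrite invr_gt0.
have gint (h : R -> R) :
   (\int[leb]_(z in Rnonneg (R := R)) (h z)%:E = \int[leb]_z ((if 0 <= z then h z else 0)%:E))%E.
  rewrite integral_mkcond; apply: eq_integral => z _.
  rewrite patchE /Rnonneg; case: ifPn => H.
    by rewrite ifT//; move: H; rewrite inE/= in_itv/= andbT.
  by rewrite ifF//; apply/negbTE; move: H; rewrite notin_setE/= in_itv/= andbT => /negP.
have mk : measurable_fun [set: R] (kernel_ext Phi alpha).
  rewrite (_ : kernel_ext Phi alpha = (fun z => alpha^-1 * g (alpha^-1 * z + 0))); last exact/funext.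
  apply: measurable_funM => //; apply: (measurableT_comp mg).
  by apply: measurable_funD => //; exact: measurable_funM.
have k0 z : 0 <= kernel_ext Phi alpha z by rewrite kE mulr_ge0// ltW.
have k1 : (\int[leb]_z (kernel_ext Phi alpha z)%:E = 1)%E.
  rewrite gint in p1.
  have mge : measurable_fun [set: R] (fun z => (alpha^-1 * g z)%:E).
    by apply/measurable_EFinP; exact: measurable_funM.
  have := @ge0_integral_affine R alpha^-1 0 (fun z => (alpha^-1 * g z)%:E) ai0 mge.
  move=> /(_ _)H; under eq_integral do rewrite kE.
  rewrite H; last by move=> x; rewrite lee_fin mulr_ge0// ltW.
  rewrite invrK; under eq_integral do rewrite EFinM.
  rewrite ge0_integralZl_EFin ?(ltW ai0)//; [|by move=> x _; rewrite lee_fin|exact/measurable_EFinP].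
  by rewrite p1 mule1 -EFinM divff// gt_eqF.
have ik : leb.-integrable [set: R] (EFin \o kernel_ext Phi alpha).
  apply/integrableP; split; first exact/measurable_EFinP.
  by under eq_integral do rewrite /= ger0_norm//; rewrite k1 ltry.
have gz0 z : 0 <= z * g z.
  by rewrite /g; case: ifPn => z0; rewrite ?mulr0// mulr_ge0// p0.
have imom : leb.-integrable [set: R] (EFin \o (fun z => z * kernel_ext Phi alpha z)).
  have mz : measurable_fun [set: R] (fun z => z * g z) by exact: measurable_funM.
  apply/integrableP; split; first by apply/measurable_EFinP; exact: measurable_funM.
  have E (z : R) : `|(EFin \o (fun z : R => z * kernel_ext Phi alpha z)%R) z|%E =
      ((alpha^-1 * z + 0) * g (alpha^-1 * z + 0))%:E.
    rewrite /= kE ger0_norm; first by congr EFin; ring.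
    rewrite (_ : z * _ = (alpha^-1 * z + 0) * g (alpha^-1 * z + 0)); last ring.
    exact: gz0.
  under eq_integral do rewrite E.
  rewrite (@ge0_integral_affine R alpha^-1 0 (fun z => (z * g z)%:E))//; last exact/measurable_EFinP.
  rewrite invrK lte_mul_pinfty// ?lee_fin ?ltW//.
  rewrite gint in pz.
  apply: le_lt_trans pz; rewrite le_eqVlt; apply/predU1P; left; apply: eq_integral => z _.
  by rewrite /g; case: ifP; rewrite ?mulr0.
split => //.
- by move=> z z0; rewrite /kernel_ext ifF// leNgt z0.
- move=> x y x0 xy; rewrite /kernel_ext x0 (le_trans x0 xy) /kernel_scaled.
  rewrite ler_wpM2l ?(ltW ai0)// pm ?divr_ge0 ?(ltW a0)//.
  by rewrite ler_wpM2r ?(ltW ai0).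
- by rewrite /Rintegral k1.
Qed.

(** Reciprocals of numbers at least 1 lie in (0, 1], where V' is bounded by its maximum over the
    compact interval [0, 1], and inversion is 1-Lipschitz on [1, oo). The sign holds because [V] and
    inversion both reverse order. *)
Lemma Wflux_lipschitz (R : realType) (V : R -> R) : flux_ok V ->
  exists2 c, 0 <= c & forall x y, 1 <= x -> 1 <= y ->
    `|Wflux V x - Wflux V y| <= c * `|x - y| /\ 0 <= (Wflux V x - Wflux V y) * (x - y).
Proof.
move=> [[dV [cdV [ddV _]]] mV].
have cn : {within `[(0:R), 1], continuous (fun x => `|dV x|)}.
  have sub : `[(0:R), 1]%classic `<=` Rnonneg (R := R).
    by move=> x /=; rewrite /Rnonneg/= !in_itv/= andbT => /andP[].
  have cc := continuous_subspaceW sub cdV.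
  by move=> x; apply: cvg_norm; exact: cc.
have [k k01 kM] := @EVT_max R (fun x => `|dV x|) 0 1 ler01 cn.
exists `|dV k| => //.
have lip a b : 0 < a -> a <= b -> b <= 1 -> `|V b - V a| <= `|dV k| * (b - a).
  move=> a0 ab b1.
  have dab x : x \in `]a, b[ -> is_derive x 1 V (dV x).
    by rewrite in_itv/= => /andP[ax _]; apply: ddV; exact: lt_trans ax.
  have cab : {within `[a, b], continuous V}.
    apply: derivable_within_continuous => x; rewrite in_itv/= => /andP[ax _].
    by have [] := ddV x (lt_le_trans a0 ax).
  have [x xab ->] := MVT_segment ab dab cab.
  rewrite normrM (ger0_norm (_ : 0 <= b - a)) ?subr_ge0// ler_wpM2r ?subr_ge0//.
  apply: kM; move: xab; rewrite !in_itv/= => /andP[ax xb].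
  by rewrite (le_trans (ltW a0) ax) (le_trans xb b1).
have main x y : 1 <= x -> x <= y ->
    `|Wflux V x - Wflux V y| <= `|dV k| * (y - x) /\ Wflux V x <= Wflux V y.
  move=> x1 xy.
  have x0 : 0 < x by lra.
  have y0 : 0 < y by lra.
  have yx : y^-1 <= x^-1 by rewrite lef_pV2.
  split; last by rewrite /Wflux mV// invr_ge0 ltW.
  apply: (le_trans (lip _ _ _ yx _)); first by rewrite invr_gt0.
    by rewrite invf_le1.
  rewrite ler_wpM2l//.
  have -> : x^-1 - y^-1 = (y - x) / (x * y) by field; rewrite !gt_eqF.
  rewrite ler_pdivrMr ?mulr_gt0// ler_peMr ?subr_ge0//.
  nra.
move=> x y x1 y1; have [xy|yx] := leP x y.
  have [H1 H2] := main x y x1 xy.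
  rewrite (distrC x) (ger0_norm (_ : 0 <= y - x)) ?subr_ge0//; split => //.
  by rewrite mulr_le0// subr_le0.
have [H1 H2] := main y x y1 (ltW yx).
rewrite distrC (ger0_norm (_ : 0 <= x - y)) ?subr_ge0 ?(ltW yx)//; split => //.
by rewrite mulr_ge0// subr_ge0// ltW.
Qed.

Lemma lip2_le (R : realType) (L L' : R) F : L <= L' -> lip2 L F -> lip2 L' F.
Proof.
move=> LL LF z z' t t'; apply: (le_trans (LF z z' t t')).
by rewrite ler_wpM2r// addr_ge0.
Qed.

Lemma lip2B (R : realType) (L L' : R) F G : lip2 L F -> lip2 L' G ->
  lip2 (L + L') (fun z t => F z t - G z t).
Proof.
move=> LF LG z z' t t'.
have -> : F z t - G z t - (F z' t' - G z' t') = (F z t - F z' t') - (G z t - G z' t') by ring.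
apply: (le_trans (ler_normB _ _)); rewrite mulrDl.
exact: lerD.
Qed.

Lemma norm_maxB_le (R : realType) (x y : R) : `|Num.max 0 x - Num.max 0 y| <= `|x - y|.
Proof.
have [x0|x0] := leP 0 x; have [y0|y0] := leP 0 y => //.
- by rewrite subr0 (ger0_norm x0) ger0_norm; lra.
- by rewrite sub0r normrN (ger0_norm y0) ler0_norm; lra.
- by rewrite subrr normr0.
Qed.

(** Replacing [t] by [Num.max 0 t] freezes the solution before time 0, so that its Lipschitz and
    boundedness properties hold on the whole plane, as [lip2] demands. *)
Lemma weak_solution_balance (R : realType) (Phi V : R -> R) (alpha : R) (y0 : R -> R)
    (w : R -> R -> R) :
  kernel_ok Phi -> flux_ok V -> 0 < alpha -> BV_R y0 ->
  bounded_sol w -> lipschitz_sol w -> values_ge1 w ->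
  weak_solution Phi alpha V w (nl_avg Phi alpha y0) ->
  let P := kernel_ext Phi alpha in
  let w' := fun z t => w z (Num.max 0 t) in
  let g := fun z t => Wflux V (w' z t) in
  exists L, exists M,
    [/\ 0 <= L, lip2 L w', lip2 L g, forall z t, `|w' z t| <= M & forall z t, `|g z t| <= M] /\
    [/\ slab_balance w' (fun z t => avg P (fun x => g x t) z) & forall z, w' z 0 = avg P y0 z].
Proof.
move=> kPhi fV a0 bvy [Mw bw] [Lw lw] gew weak P w' g.
have kP : is_kernel P := kernel_ext_is_kernel kPhi a0.
have [c c0 Wl] := Wflux_lipschitz fV.
have [My yM] := BV_bounded bvy; have my := BV_measurable bvy.
have max0 (t : R) : 0 <= Num.max 0 t by rewrite le_max lexx.
have P0 := kernel_ge0 kP 0.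
have My0 : 0 <= My := le_trans (normr_ge0 _) (yM 0).
have Mw0 : 0 <= Mw := le_trans (normr_ge0 _) (bw 0 0 (lexx _)).
have lw' : lip2 `|Lw| w'.
  move=> z z' t t'; apply: (le_trans (lw z z' _ _ (max0 t) (max0 t'))).
  apply: (@le_trans _ _ (`|Lw| * (`|z - z'| + `|Num.max 0 t - Num.max 0 t'|))).
    by rewrite ler_wpM2r ?addr_ge0// ler_norm.
  by rewrite ler_wpM2l// lerD2l norm_maxB_le.
have w'1 z t : 1 <= w' z t by exact: gew.
have lg : lip2 (c * `|Lw|) g.
  move=> z z' t t'; apply: (le_trans (proj1 (Wl _ _ (w'1 z t) (w'1 z' t')))).
  by rewrite -mulrA ler_wpM2l.
(* One constant for [w'], for the flux, and for the averaged datum, whose own Lipschitz constant is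
   [2 * P 0 * My]. *)
pose L := `|Lw| + c * `|Lw| + 2 * P 0 * My.
have Lwc : 0 <= c * `|Lw| by rewrite mulr_ge0.
have PM : 0 <= 2 * P 0 * My by rewrite !mulr_ge0.
have L0 : 0 <= L by rewrite !addr_ge0.
have lwL : lip2 L w' by apply: lip2_le lw'; rewrite /L; lra.
have lgL : lip2 L g by apply: lip2_le lg; rewrite /L; have := normr_ge0 Lw; lra.
pose M := Mw + `|Wflux V 1| + c * (Mw + 1) + My.
have cM : 0 <= c * (Mw + 1) by rewrite mulr_ge0// addr_ge0.
have wM z t : `|w' z t| <= M.
  by apply: (le_trans (bw _ _ (max0 t))); rewrite /M; have := normr_ge0 (Wflux V 1); lra.
have gM z t : `|g z t| <= M.
  have /= H := proj1 (Wl _ _ (w'1 z t) (lexx 1)).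
  have H1 := ler_normD (g z t - Wflux V 1) (Wflux V 1); rewrite subrK in H1.
  have H2 : `|w' z t - 1| <= Mw + 1.
    by apply: (le_trans (ler_normB _ _)); rewrite normr1 lerD2r bw.
  have H3 : c * `|w' z t - 1| <= c * (Mw + 1) by rewrite ler_wpM2l.
  by rewrite /M; move: H H1 H3; rewrite -/(g z t); lra.
have M0 : 0 <= M := le_trans (normr_ge0 _) (wM 0 0).
exists L, M; split => //.
pose w0 z := avg P y0 z.
have Lw0 z z' : `|w0 z - w0 z'| <= L * `|z - z'|.
  wlog zz : z z' / z' <= z.
    move=> H; have [zz|/ltW zz] := leP z' z; first exact: H.
    by rewrite distrC (distrC z); exact: H.
  have [->|zn] := eqVneq z z'; first by rewrite !subrr normr0 mulr0.
  have d0 : 0 < z - z' by rewrite subr_gt0 lt_neqAle eq_sym zn.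
  have := avg_increment_le z' kP d0 my yM.
  rewrite [z' + _]addrC subrK (gtr0_norm d0) => /le_trans; apply.
  rewrite mulrC ler_wpM2r// ?(ltW d0)// /L; have := normr_ge0 Lw; lra.
have mw0 : measurable_fun [set: R] w0.
  apply: (@lip2_measurable1 _ L (fun z _ => w0 z) 0 L0) => z z' t t'.
  by apply: (le_trans (Lw0 z z')); rewrite ler_wpM2l// lerDl.
have w0M z : `|w0 z| <= M.
  apply: (le_trans (norm_avg_le z kP my yM)); rewrite /M; have := normr_ge0 (Wflux V 1); lra.
pose B z t := avg P (fun x => g x t) z.
have LB : lip2 L B by exact: (avg_lip2 kP L0 lgL gM).
have BM z t : `|B z t| <= M.
  exact: (norm_avg_le z kP (lip2_measurable1 t L0 lgL) (fun x => gM x t)).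
have slab T a b : 0 < T -> a < b ->
    \int[leb]_(z in `[a, b]) (w' z T - w0 z) = \int[leb]_(t in `[0, T]) (B b t - B a t).
  move=> T0 ab; apply: (slab_identity L0 lwL LB wM BM mw0 w0M T0 ab) => phi tphi.
  have := weak T T0 phi tphi.
  rewrite (_ : Rintegral leb _ _ = Rintegral leb setT (fun z => w' z T * phi z T - w0 z * phi z 0)).
    move=> <-; rewrite [LHS]Rintegral_mkcond [RHS]Rintegral_mkcond.
    congr (Rintegral _ _ _); apply/funext; case=> z t; rewrite !patchE.
    case: ifPn => //; rewrite in_setX in_setT/= inE/= in_itv/= => /andP[t0 tT].
    have wt x : w' x t = w x t by rewrite /w' (max_r t0).
    have gE : (fun x => g x t) = (fun x => Wflux V (w x t)).
      by apply/funext => x; rewrite /g wt.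
    have Bt : B z t = nl_avg Phi alpha (fun x => Wflux V (w x t)) z.
      by rewrite nl_avgE -gE.
    by rewrite wt Bt.
  apply: eq_Rintegral => z _; rewrite /w' (max_r (ltW T0)) /w0.
  by rewrite nl_avgE.
split.
  exact: (slab_balance_of L0 M0 lwL LB BM Lw0 mw0 slab).
exact: (slab_initial L0 M0 lwL LB BM Lw0 mw0 slab).
Qed.


(** Young's inequality for a kernel of mass 1. It is the case [Q = 0] of [weighted_corr_le]: since
    every translated tent is at most 1, the full integral of |h| can serve as [J]. *)
Lemma avg_l1_le (R : realType) (P h : R -> R) (M : R) : is_kernel P ->
  (forall x, `|h x| <= M) -> leb.-integrable [set: R] (EFin \o h) ->
  measurable_fun [set: R] (avg P h) ->
  (\int[leb]_x (`|avg P h x|)%:E <= (\int[leb]_x `|h x|)%:E)%E.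
Proof.
move=> kP hM ih mavg.
have mh : measurable_fun [set: R] h by apply/measurable_EFinP; exact: (measurable_int _ ih).
have mah : measurable_fun [set: R] (fun x => `|h x|) by exact: measurableT_comp.
have iah : leb.-integrable [set: R] (EFin \o (fun x => `|h x|)) by exact: (integrable_norm ih).
have hM' x : 0 <= `|h x| <= M by rewrite normr_ge0 hM.
have hM'' x : `| `|h x| | <= M by rewrite normr_id.
pose G a := \int[leb]_s (P s * `|h (a + s)|).
have mG : measurable_fun [set: R] G.
  exact: (measurable_corr (kernel_int kP) (kernel_ge0 kP) mah hM').
have G0 a : 0 <= G a.
  by apply: Rintegral_ge0 => s _; rewrite mulr_ge0// kernel_ge0.
have avgG a : `|avg P h a| <= G a.
  apply: leb_norm_le.
  - by apply: measurable_funM; [exact: kernel_meas | exact: measurable_shift].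
  - by move=> s; rewrite normrM (ger0_norm (kernel_ge0 kP s)).
  - exact: (integrable_bddM (kernel_int kP) (measurable_shift a mah) (fun s => hM'' (a + s))).
have GM a : `|G a| <= M * \int[leb]_s P s.
  apply: norm_kintegral_le; first exact: kernel_int.
  - exact: kernel_ge0.
  - exact: (measurable_shift a mah).
  - by move=> s _; rewrite hM''.
apply: tent_exhaustion => // [|n]; first exact: measurableT_comp.
have n0 : (0 : R) < n.+1%:R by rewrite ltr0n.
have itG := integrable_bddM (integrable_tent n0) mG GM.
apply: (@le_trans _ _ (\int[leb]_x (tent n.+1%:R x * G x))%:E).
  rewrite EFin_Rintegral//; apply: ge0_le_integral => //.
  - by move=> x _; rewrite lee_fin mulr_ge0// tent_ge0.
  - apply/measurable_EFinP; apply: measurable_funM; first exact: measurable_tent.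
    exact: measurableT_comp.
  - by apply/measurable_EFinP; apply: measurable_funM => //; exact: measurable_tent.
  - by move=> x _; rewrite lee_fin ler_wpM2l// tent_ge0.
rewrite lee_fin.
have := @weighted_corr_le R (tent n.+1%:R) P (fun x => `|h x|) M (\int[leb]_x `|h x|) 0 1
  (\int[leb]_s (s * P s)) (integrable_tent n0) (tent_ge0 _) (kernel_int kP) (kernel_ge0 kP)
  (kernel_moment kP) (kernel_neg kP) mah hM' (kernel_mass kP) (lexx _) (lexx _).
rewrite mul1r mulr0 addr0; apply => s s0; rewrite mulr0 addr0.
apply: le_Rintegral => //.
  exact: (integrable_bddM (integrable_shift (- s) (integrable_tent n0)) mah hM'').
move=> x _; rewrite ler_piMl// (le_trans (tent_le_indic _ n0))//.
Qed.

(** A positive value at [x] would persist to its right: comparing [g] with [g x] on [[x, x + d]]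
    gives [g x <= L * d] for every [d]. *)
Lemma lipschitz_integral_eq0 (R : realType) (g : R -> R) (L : R) :
  measurable_fun [set: R] g -> (forall x, 0 <= g x) -> 0 <= L ->
  (forall x y, `|g x - g y| <= L * `|x - y|) ->
  (\int[leb]_x (g x)%:E <= 0)%E -> forall x, g x = 0.
Proof.
move=> mg g0 L0 Lg gint x.
have [ig gA] := Rintegral_le_of_integral mg g0 gint.
apply: (@small_multiple_eq _ L) => d d0; rewrite subr0 (ger0_norm (g0 x)).
have xd : x <= x + d by lra.
have [||y|_ H] := @Rintegral_near R `[x, x + d]%classic (x + d - x) (g x) (L * d) g
  (measurable_itv _) (leb_itvcc xd).
- exact: mg.
- by rewrite mulr_ge0// ltW.
- rewrite /= in_itv/= => /andP[xy yd]; apply: (le_trans (Lg y x)).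
  by rewrite ler_wpM2l// ger0_norm; lra.
have I0 : \int[leb]_(y in `[x, x + d]) g y <= 0.
  apply: le_trans gA; rewrite Rintegral_mkcond; apply: le_Rintegral => //.
    have := @integrable_mkcond _ _ R leb setT (EFin \o g) measurableT.
    move=> _; apply: (leb_dominated _ _ ig).
      apply/(measurable_restrictT _ _).1 => //.
      exact: measurable_funTS.
    by move=> y; rewrite patchE; case: ifP => // _; rewrite ?normr0// ger0_norm.
  by move=> y _; rewrite patchE; case: ifP => // _.
move: H; rewrite [x + d]addrC addrK [d + x]addrC ler_norml => /andP[H _].
have : d * g x <= d * (L * d) by lra.
by rewrite ler_pM2l.
Qed.

Theorem theorem5p3 (R : realType) (Phi V : R -> R) (alpha : R)
    (y0 r0 : R -> R) (w v : R -> R -> R) :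
  kernel_ok Phi -> flux_ok V -> 0 < alpha ->
  BV_R y0 -> BV_R r0 -> (forall z, 1 <= y0 z) -> (forall z, 1 <= r0 z) ->
  bounded_sol w -> lipschitz_sol w -> values_ge1 w ->
  weak_solution Phi alpha V w (nl_avg Phi alpha y0) ->
  bounded_sol v -> lipschitz_sol v -> values_ge1 v ->
  weak_solution Phi alpha V v (nl_avg Phi alpha r0) ->
  ((@lebesgue_measure R).-integrable [set: R] (fun z => (y0 z - r0 z)%:E) ->
   forall t : R, 0 < t ->
     (@lebesgue_measure R).-integrable [set: R] (fun z => (w z t - v z t)%:E) /\
     (\int[@lebesgue_measure R]_(z in [set: R]) (`|w z t - v z t|)%:E
        <= \int[@lebesgue_measure R]_(z in [set: R]) (`|y0 z - r0 z|)%:E)%E)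
  /\
  ((forall z, y0 z = r0 z) -> forall z t, 0 <= t -> w z t = v z t).
Proof.
move=> kPhi fV a0 bvy bvr _ _ bw lw gew weakw bv lv gev weakv.
have kP := kernel_ext_is_kernel kPhi a0.
have [c c0 Wl] := Wflux_lipschitz fV.
have [Lw [Mw [[Lw0 lw' lgw wM gwM] [balw w0E]]]] :=
  weak_solution_balance kPhi fV a0 bvy bw lw gew weakw.
have [Lv [Mv [[Lv0 lv' lgv vM gvM] [balv v0E]]]] :=
  weak_solution_balance kPhi fV a0 bvr bv lv gev weakv.
have [My yM] := BV_bounded bvy; have my := BV_measurable bvy.
have [Mr rM] := BV_bounded bvr; have mr := BV_measurable bvr.
set P := kernel_ext Phi alpha in kP balw w0E balv v0E.
pose u z t := w z (Num.max 0 t) - v z (Num.max 0 t).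
pose f z t := Wflux V (w z (Num.max 0 t)) - Wflux V (v z (Num.max 0 t)).
have max0 (t : R) : 0 <= Num.max 0 t by rewrite le_max lexx.
have L0 : 0 <= Lw + Lv by rewrite addr_ge0.
have Lu : lip2 (Lw + Lv) u by exact: (lip2B lw' lv').
have Lf : lip2 (Lw + Lv) f by exact: (lip2B lgw lgv).
have bound (a b A B : R) : `|a| <= A -> `|b| <= B -> `|a - b| <= A + B.
  by move=> aA bB; apply: (le_trans (ler_normB _ _)); exact: lerD.
have tr : transport P u f (Lw + Lv) (Mw + Mv) (Mw + Mv) c.
  split; [exact: kP | exact: L0 | exact: Lu | exact: Lf | | | | | exact: c0 |].
  - by move=> z t; apply: bound.
  - by move=> z t; apply: bound.
  - by move=> z t; have [_] := Wl _ _ (gew z _ (max0 t)) (gev z _ (max0 t)).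
  - by move=> z t; have [] := Wl _ _ (gew z _ (max0 t)) (gev z _ (max0 t)).
  have wle F : lip2 Lw F -> lip2 (Lw + Lv) F by apply: lip2_le; rewrite lerDl.
  have vle F : lip2 Lv F -> lip2 (Lw + Lv) F by apply: lip2_le; rewrite lerDr.
  have := slab_balanceB L0 (wle _ lw') (vle _ lv') (wle _ (avg_lip2 kP Lw0 lgw gwM))
    (vle _ (avg_lip2 kP Lv0 lgv gvM)) balw balv.
  congr slab_balance; apply/funext => z; apply/funext => t.
  rewrite (@avgB _ _ _ _ (Mw + Mv) _ _ kP (lip2_measurable1 t Lw0 lgw) (lip2_measurable1 t Lv0 lgv))//.
  - by move=> x; apply: (le_trans (gwM x t)); rewrite lerDl (le_trans _ (gvM 0 0)).
  - by move=> x; apply: (le_trans (gvM x t)); rewrite lerDr (le_trans _ (gwM 0 0)).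
have mu t : measurable_fun [set: R] (fun x => u x t) := lip2_measurable1 t L0 Lu.
pose h z := y0 z - r0 z.
have hM z : `|h z| <= My + Mr by exact: bound.
(* Averaging is linear, so the contraction can start from the L^1 bound for the average of
   [y0 - r0]. *)
have u0E : (fun z => u z 0) = avg P h.
  apply/funext => z; rewrite /u w0E v0E.
  rewrite (@avgB _ _ _ _ (My + Mr) _ _ kP my mr)//.
  - by move=> x; apply: (le_trans (yM x)); rewrite lerDl (le_trans _ (rM 0)).
  - by move=> x; apply: (le_trans (rM x)); rewrite lerDr (le_trans _ (yM 0)).
have contr : leb.-integrable [set: R] (EFin \o h) -> forall t, 0 < t ->
    (\int[leb]_x (`|u x t|)%:E <= (\int[leb]_x `|h x|)%:E)%E.
  move=> ih t t0; apply: (l1_contraction tr _ t0).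
  have := avg_l1_le kP hM ih; rewrite -u0E; apply; exact: mu.
have uE z t : 0 <= t -> u z t = w z t - v z t by move=> t0; rewrite /u max_r.
split.
  move=> ih t t0; have H := contr ih t t0.
  have iah : leb.-integrable [set: R] (EFin \o (fun x => `|h x|)) by exact: (integrable_norm ih).
  rewrite EFin_Rintegral// in H.
  have E : (fun z => (w z t - v z t)%:E) = EFin \o (fun z => u z t).
    by apply/funext => z; rewrite /= uE// ltW.
  split; last by under eq_integral do rewrite -uE ?ltW//.
  rewrite E; apply/integrableP; split; first by apply/measurable_EFinP; exact: mu.
  by apply: le_lt_trans H _; move/integrableP: ih => [].
move=> yr z t t0; apply/eqP; rewrite -subr_eq0 -uE//; apply/eqP.
have h0 : h = (fun _ => 0) by apply/funext => x; rewrite /h yr subrr.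
(* The contraction concerns positive times only; at time 0 both solutions equal their averaged data,
   which coincide. *)
move: t0; rewrite le_eqVlt => /predU1P[<-|t0].
  have /(congr1 (fun F => F z)) -> := u0E.
  rewrite h0 /avg; under eq_Rintegral do rewrite mulr0.
  by rewrite Rintegral_cst// mul0r.
(* For equal data the contraction makes the L^1 norm of the difference vanish, and Lipschitz
   continuity in space turns this into equality at every point. *)
apply/eqP; rewrite -normr_eq0; apply/eqP.
apply: (@lipschitz_integral_eq0 _ (fun x => `|u x t|) (Lw + Lv)) => //.
- exact: measurableT_comp.
- move=> x y; apply: (le_trans (ler_dist_dist _ _)).
  by have := Lu x y t t; rewrite subrr normr0 addr0.
have i0 : leb.-integrable [set: R] (EFin \o h).
  by rewrite h0; exact: integrable0.
have := contr i0 t t0; rewrite h0.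
under eq_Rintegral do rewrite normr0.
by rewrite Rintegral_cst// mul0r.
Qed.
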